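(* Let $q\in(1,\infty)$ and let $C_{1}$ and $C_{2}$ be positive constants. Let $E$ be a normed sequence space which is a subset of $\ell^{q}$ and has property $S_{q}(C_{1})$. Suppose, furthermore, that $E$ is a normed $C_{2}$-interpolation space with respect to the couple $(\ell^{1},\ell^{\infty})$. Then $E$ is also a normed $C_{3}$-$K$ space and a normed $C_{3}$-interpolation space with respect to the couple $(\ell^{1},\ell^{q})$ for a constant $C_{3}$ which depends only on $q$, $C_{1}$ and $C_{2}$.
   Context: All linear spaces are over a base field which is either $\mathbb{R}$ or $\mathbb{C}$ (the result is asserted for each of the two fields). Sequences are indexed by $\mathbb{N}=\{1,2,\dots\}$. A normed sequence space $E$ is a linear space $E\neq\{0\}$ of scalar sequences equipped with a norm $\|\cdot\|_E$; it is not assumed to be complete, and set inclusions such as $E\subset \ell^q$ are not assumed to be continuous. For a bounded scalar sequence $\{x_n\}_{n\in\mathbb{N}}$, $\{x_n^*\}_{n\in\mathbb{N}}$ denotes its nonincreasing rearrangement, $x_n^*=\inf\{\lambda\ge 0 : \#\{k:|x_k|>\lambda\}\le n-1\}$. Property $S_q(C)$ (for $q\in[1,\infty)$ and $C>0$): $E$ has property $S_q(C)$ if, whenever $\{u_n\}$ and $\{v_n\}$ are two sequences in $\ell^q$ satisfying $\sum_{n=1}^N (u_n^* )^q\le\sum_{n=1}^N (v_n^* )^q$ for all $N\in\mathbb{N}$ and $\sum_{n=1}^\infty (u_n^* )^q=\sum_{n=1}^\infty (v_n^* )^q$, and $\{u_n\}\in E$, it follows that $\{v_n\}\in E$ and $\|\{v_n\}\|_E\le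 C\|\{u_n\}\|_E$. For a Banach couple $(A_0,A_1)$, $\mathcal{L}_1((A_0,A_1))$ denotes the set of all linear maps $T:A_0+A_1\to A_0+A_1$ such that, for $j=0,1$, $T(A_j)\subset A_j$ and $\|Ta\|_{A_j}\le\|a\|_{A_j}$ for all $a\in A_j$. A normed space $A\neq\{0\}$ contained in $A_0+A_1$ is a normed $C$-interpolation space with respect to $(A_0,A_1)$ if every $T\in\mathcal{L}_1((A_0,A_1))$ satisfies $T(A)\subset A$ and $\|Ta\|_A\le C\|a\|_A$ for all $a\in A$. The $K$-functional is $K(t,x;A_0,A_1)=\inf\{\|a_0\|_{A_0}+t\|a_1\|_{A_1}: x=a_0+a_1,\ a_j\in A_j\}$ for $x\in A_0+A_1$, $t>0$. A normed space $A\neq\{0\}$ contained in $A_0+A_1$ is a normed $C$-$K$ space with respect to $(A_0,A_1)$ if, whenever $x,y\in A_0+A_1$ satisfy $K(t,y;A_0,A_1)\le K(t,x;A_0,A_1)$ for all $t>0$ and $x\in A$, it follows that $y\in A$ and $\|y\|_A\le C\|x\|_A$. *)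

(* Defs.v *)
From HB Require Import structures.
From mathcomp Require Import all_boot all_order all_algebra.
From mathcomp Require Import all_classical all_reals all_analysis.
From mathcomp Require Import complex.

Set Implicit Arguments.
Unset Strict Implicit.
Unset Printing Implicit Defensive.
Import Order.TTheory GRing.Theory Num.Theory.
Import numFieldNormedType.Exports.

Local Open Scope classical_set_scope.
Local Open Scope ring_scope.

(* A scalar field with an R-valued modulus (the library norm on R[i] is
   R[i]-valued). It carries no axioms: only the two instances below are used. *)
Record scalars (R : realType) := Scalars {
  scalar_field :> fieldType;
  modulus : scalar_field -> R }.

Definition real_scalars (R : realType) : scalars R :=
  @Scalars R R (fun x => `|x|).

Definition complex_scalars (R : realType) : scalars R :=
  @Scalars R R[i] (@ComplexField.Normc.normc R).

(* Sequences indexed by {1, 2, ...} are shifted to start at 0. *)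

(* A set of sequences with a candidate norm, whose values outside the set are
   irrelevant. The axioms are stated separately in [normed_seqspace]. *)
Record seqspace (R : realType) (F : scalars R) := SeqSpace {
  carrier :> (nat -> F) -> Prop;
  nrm : (nat -> F) -> R }.

Section NormedSequenceSpaces.
Context {R : realType} {F : scalars R}.
Implicit Types (A : seqspace F) (x y u v : nat -> F).

(* Nontrivial by definition; completeness is not required. *)
Definition normed_seqspace A : Prop :=
  [/\ [/\ A 0,
          forall x y, A x -> A y -> A (x + y)
        & forall (a : F) x, A x -> A (a \*o x)],
      [/\ forall x, A x -> 0 <= nrm A x,
          forall x, A x -> nrm A x = 0 -> x = 0,
          forall (a : F) x, A x -> nrm A (a \*o x) = modulus a * nrm A x
        & forall x y, A x -> A y -> nrm A (x + y) <= nrm A x + nrm A y]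
    & exists2 x, A x & x <> 0].

Definition ell_enorm (p : \bar R) x : \bar R :=
  Lnorm (@counting nat R) p (fun n => (modulus (x n))%:E).

(* Meaningful for p in [1, +oo]. *)
Definition ell (p : \bar R) : seqspace F :=
  SeqSpace (fun x => (ell_enorm p x < +oo)%E) (fun x => fine (ell_enorm p x)).

(* x_{n+1}^* in 1-based indexing. *)
Definition rearr x (n : nat) : R :=
  inf [set l : R | 0 <= l /\ ([set k | (l < modulus (x k))%R] #<= `I_n)%card].

Definition property_S (q C : R) A : Prop :=
  forall u v,
    ell q%:E u -> ell q%:E v ->
    (forall N : nat,
       \sum_(n < N) rearr u n `^ q <= \sum_(n < N) rearr v n `^ q) ->
    (\sum_(0 <= n <oo) (rearr u n `^ q)%:E =
     \sum_(0 <= n <oo) (rearr v n `^ q)%:E)%E ->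
    A u -> A v /\ nrm A v <= C * nrm A u.

Definition couple_sum (A0 A1 : seqspace F) : set (nat -> F) :=
  [set x | exists a0 a1, [/\ A0 a0, A1 a1 & x = a0 + a1]].

(* A map A0 + A1 -> A0 + A1 is represented by a function on all sequences,
   constrained only on A0 + A1. *)
Definition couple_contraction (A0 A1 : seqspace F)
    (T : (nat -> F) -> (nat -> F)) : Prop :=
  [/\ forall x, couple_sum A0 A1 x -> couple_sum A0 A1 (T x),
      forall (a : F) x y, couple_sum A0 A1 x -> couple_sum A0 A1 y ->
        T (a \*o x + y) = a \*o T x + T y,
      forall x, A0 x -> A0 (T x) /\ nrm A0 (T x) <= nrm A0 x
    & forall x, A1 x -> A1 (T x) /\ nrm A1 (T x) <= nrm A1 x].

Definition interpolation_space (C : R) (A0 A1 A : seqspace F) : Prop :=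
  [/\ normed_seqspace A, carrier A `<=` couple_sum A0 A1
    & forall T, couple_contraction A0 A1 T ->
        forall x, A x -> A (T x) /\ nrm A (T x) <= C * nrm A x].

Definition Kfun (A0 A1 : seqspace F) (t : R) x : R :=
  inf [set r | exists a0 a1,
    [/\ A0 a0, A1 a1, x = a0 + a1 & r = nrm A0 a0 + t * nrm A1 a1]].

Definition K_space (C : R) (A0 A1 A : seqspace F) : Prop :=
  [/\ normed_seqspace A, carrier A `<=` couple_sum A0 A1
    & forall x y, couple_sum A0 A1 x -> couple_sum A0 A1 y ->
        (forall t, 0 < t -> Kfun A0 A1 t y <= Kfun A0 A1 t x) ->
        A x -> A y /\ nrm A y <= C * nrm A x].

End NormedSequenceSpaces.

(* Main.v *)
(* Holmstedt's formula gives, for [t = N^(1 - 1/q)], that [K(t, x; l^1, l^q)] is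
   comparable to [A_x(N) + t * W_x(N)^(1/q)], where [A_x(N)] is the sum of the
   first [N] terms of [x^*] and [W_x(N)] is the sum of [(x^*_n)^q] over [n > N].
   Hence if [K(., y) <= K(., x)], then every [N] is of one of two kinds: either
   [A_y(N) <= 8 A_x(N)], or [W_y(N)] and [N (y^*_N)^q] are at most [8^q W_x(N)].
   Let [G0] and [G1] be the least nonincreasing majorants of [y^*] restricted to
   the indices of the first and of the second kind. Then [A_G0 <= 16 A_x] and
   [W_G1 <= 16^q W_x] everywhere, so that [G0] is controlled by interpolation
   between [l^1] and [l^oo] (Calderon's theorem, here with an explicit lower
   triangular matrix), [G1] is controlled by the property [S_q] once its first
   term is raised to equalize the totals, and [y^* <= G0 + G1]. *)

Require Import Defs.
From HB Require Import structures.
From mathcomp Require Import all_boot all_order all_algebra.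
From mathcomp Require Import all_classical all_reals all_analysis.
From mathcomp Require Import ess_sup_inf complex ring lra.

Set Implicit Arguments.
Unset Strict Implicit.
Unset Printing Implicit Defensive.
Import Order.TTheory GRing.Theory Num.Theory.
Import numFieldNormedType.Exports.

Local Open Scope classical_set_scope.
Local Open Scope ring_scope.

(** * Scalars and l^p norms *)

(** Since [scalars] carries no axioms, the properties of the modulus used below are gathered here,
    so that both fields are treated at once; [emb] turns real rearrangements into scalar
    sequences. *)
Record valued_scalars (R : realType) (F : scalars R) (emb : R -> F) : Prop :=
  ValuedScalars {
    modM : forall a b : F, modulus (a * b) = modulus a * modulus b;
    modD : forall a b : F, modulus (a + b) <= modulus a + modulus b;
    mod_emb : forall r : R, modulus (emb r) = `|r|;
    mod_ge0 : forall a : F, 0 <= modulus a;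
    mod_eq0 : forall a : F, modulus a = 0 -> a = 0 }.

Lemma real_scalars_valued (R : realType) :
  @valued_scalars R (real_scalars R) (@idfun R).
Proof.
split => //=; [exact: normrM | exact: ler_normD |].
by move=> a /eqP; rewrite normr_eq0 => /eqP.
Qed.

Lemma complex_scalars_valued (R : realType) :
  @valued_scalars R (complex_scalars R) (@real_complex_def R (Phant R)).
Proof.
split => /=.
- exact: ComplexField.Normc.normcM.
- exact: le_normcD.
- by move=> r; rewrite expr0n addr0 sqrtr_sqr.
- by case=> a b; exact: sqrtr_ge0.
- exact: ComplexField.Normc.eq0_normc.
Qed.

Lemma scalars_valued (R : realType) (F : scalars R) :
  F = real_scalars R \/ F = complex_scalars R ->
  exists emb : {rmorphism R -> F}, valued_scalars emb.
Proof.
case=> ->; first by exists (@idfun R); exact: real_scalars_valued.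
by exists (real_complex R); exact: complex_scalars_valued.
Qed.

Section EllNorm.
Context {R : realType} {F : scalars R} (mge0 : forall a : F, 0 <= modulus a).
Implicit Types (x : nat -> F) (r p : R).

(** Membership accompanies the norm bound because [fine] sends [+oo] to 0, which makes a bound on
    [nrm] alone meaningless. *)
Lemma ell_enormP (p : \bar R) x r :
  ell p x /\ nrm (ell p) x <= r <-> (ell_enorm p x <= r%:E)%E.
Proof.
have e0 : (0 <= ell_enorm p x)%E by exact: Lnorm_ge0.
rewrite /ell /=; split => [[xoo xr]|xr].
  by rewrite -[ell_enorm p x]fineK ?ge0_fin_numE// lee_fin.
have xoo : (ell_enorm p x < +oo)%E by rewrite (le_lt_trans xr) ?ltry.
by split => //; rewrite -lee_fin fineK// ge0_fin_numE.
Qed.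

(** Trades the infinite sum for bounds on all partial sums, the form in which later estimates handle
    l^p norms. *)
Lemma ellP p x r : 0 < p -> 0 <= r ->
  ell p%:E x /\ nrm (ell p%:E) x <= r <->
  forall n, \sum_(k < n) modulus (x k) `^ p <= r `^ p.
Proof.
move=> p0 r0; rewrite ell_enormP /ell_enorm Lnorm_counting//.
under eq_eseriesr => k _ do rewrite /= ger0_norm ?mge0//.
set S := limn _.
have S0 : (0 <= S)%E.
  by apply: nneseries_ge0 => k _ _; rewrite lee_fin powR_ge0.
have in0y (z : \bar R) : (0 <= z)%E -> z \in `[0%E, +oo%E].
  by move=> z0; rewrite in_itv/= z0 leey.
split => [Sr n|hr].
  have : (S <= (r `^ p)%:E)%E.
    have := gt0_ler_poweR (ltW p0) (in0y _ (poweR_ge0 S p^-1)) (in0y r%:E r0) Sr.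
    by rewrite -poweRrM mulVf ?gt_eqF// poweRe1// poweR_EFin.
  move=> Srp; rewrite -lee_fin; apply: le_trans Srp; rewrite -sumEFin.
  rewrite -(big_mkord xpredT (fun k => (modulus (x k) `^ p)%:E)).
  by apply: nneseries_lim_ge => k _; rewrite lee_fin powR_ge0.
have Sr : (S <= (r `^ p)%:E)%E.
  apply: lime_le.
    by apply: is_cvg_nneseries => k _ _; rewrite lee_fin powR_ge0.
  by apply: nearW => n; rewrite big_mkord sumEFin lee_fin.
have pV0 : 0 <= p^-1 by rewrite invr_ge0 ltW.
have rp0 : (0 <= (r `^ p)%:E)%E by rewrite lee_fin powR_ge0.
have := gt0_ler_poweR pV0 (in0y _ S0) (in0y _ rp0) Sr.
by rewrite poweR_EFin -powRrM divff ?gt_eqF// powRr1.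
Qed.

Lemma ell_ooP x r : 0 <= r ->
  ell +oo%E x /\ nrm (ell +oo%E) x <= r <-> forall k, modulus (x k) <= r.
Proof.
(* The norm at [+oo] is the essential supremum only on a space of positive measure; the counting
   measure of [nat] is infinite. *)
move=> r0; rewrite ell_enormP /ell_enorm unlock /= ifT; last first.
  rewrite lt_neqAle measure_ge0 andbT eq_sym /= /counting asboolF//.
  exact: infinite_nat.
split => [/ess_supP|xr].
- case=> A [mA A0 sub] k; apply/negP => /negP; rewrite -ltNge => rk.
  have /sub Ak : (~` [set y | (abse \o (fun n => (modulus (x n))%:E)) y <= r%:E]%E) k.
    by rewrite /= ger0_norm ?mge0// lee_fin; apply/negP; rewrite -ltNge.
  (* A point where the bound fails would give the null set [A] counting measure at least 1. *)
  have : (counting (R:=R) [set k] <= counting (R:=R) A)%E.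
    by apply: le_measure; rewrite ?inE// => _ ->.
  rewrite A0 /counting asboolT; last exact: finite_set1.
  by rewrite fset_set1 finmap.cardfs1 lee_fin ler10.
- apply/ess_supP; apply: nearW => k /=.
  by rewrite ger0_norm ?mge0// lee_fin.
Qed.

End EllNorm.

(** * Sums, tails and nonincreasing majorants *)

Section Totals.
Context {R : realType}.
Implicit Types (h : nat -> R) (b : R).

(** A real-valued total. For unbounded partial sums [sup] takes a default value, hence the bound [b]
    carried by the lemmas below. *)
Definition nnsum h : R := sup (range (fun n => \sum_(k < n) h k)).

Definition tail h (N : nat) : R := nnsum h - \sum_(k < N) h k.

Lemma nnsum_le h b : (forall n, \sum_(k < n) h k <= b) -> nnsum h <= b.
Proof.
move=> hb; apply: ge_sup; first by exists (\sum_(k < 0) h k), 0%N.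
by move=> _ [n _ <-].
Qed.

Lemma le_nnsum h b n : (forall n, \sum_(k < n) h k <= b) ->
  \sum_(k < n) h k <= nnsum h.
Proof.
move=> hb; apply: ub_le_sup; last by exists n.
by exists b => _ [m _ <-].
Qed.

Lemma tail0 h : tail h 0 = nnsum h.
Proof. by rewrite /tail big_ord0 subr0. Qed.

Lemma le_tail h b N M : (forall n, \sum_(k < n) h k <= b) -> (N <= M)%N ->
  \sum_(N <= k < M) h k <= tail h N.
Proof.
move=> hb NM; rewrite /tail lerBrDr addrC.
rewrite -(big_mkord xpredT h) -big_cat_nat//= big_mkord.
exact: le_nnsum hb.
Qed.

Lemma tail_le h b N : (forall k, 0 <= h k) ->
  (forall M, (N <= M)%N -> \sum_(N <= k < M) h k <= b) -> tail h N <= b.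
Proof.
move=> h0 hb; rewrite /tail lerBlDr; apply: nnsum_le => n.
have [Nn|/ltnW nN] := leqP N n.
  by rewrite -!(big_mkord xpredT h) (big_cat_nat (leq0n _) Nn)//= addrC lerD2r hb.
have b0 : 0 <= b by have := hb N (leqnn N); rewrite big_geq.
rewrite -[leLHS]add0r lerD// -!(big_mkord xpredT h) (big_cat_nat (leq0n _) nN)//=.
by rewrite lerDl sumr_ge0.
Qed.

Lemma tail_ge0 h b N : (forall n, \sum_(k < n) h k <= b) -> 0 <= tail h N.
Proof. by move=> hb; rewrite subr_ge0 (le_nnsum _ hb). Qed.

Lemma tail_nincr h N M : (forall k, 0 <= h k) -> (N <= M)%N ->
  tail h M <= tail h N.
Proof.
move=> h0 NM; rewrite lerD2l lerN2 -!(big_mkord xpredT h) (big_cat_nat (leq0n _) NM)//=.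
by rewrite lerDl sumr_ge0.
Qed.

Lemma nneseries_nnsum h b : (forall k, 0 <= h k) ->
  (forall n, \sum_(k < n) h k <= b) ->
  (\sum_(0 <= k <oo) (h k)%:E = (nnsum h)%:E)%E.
Proof.
move=> h0 hb; apply/eqP; rewrite eq_le; apply/andP; split.
  apply: lime_le.
    by apply: is_cvg_nneseries => k _ _; rewrite lee_fin.
  by apply: nearW => n; rewrite big_mkord sumEFin lee_fin (le_nnsum _ hb).
set S := limn _.
have hS n : ((\sum_(k < n) h k)%:E <= S)%E.
  rewrite -sumEFin -(big_mkord xpredT (fun k => (h k)%:E)).
  by apply: nneseries_lim_ge => k _; rewrite lee_fin.
case: S hS => [s hS| |/(_ 0%N)]; last by rewrite big_ord0.
- by rewrite lee_fin; apply: nnsum_le => n; rewrite -lee_fin.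
- by rewrite leey.
Qed.

End Totals.

Lemma nnsumZ (R : realType) (h : nat -> R) (c b : R) : 0 < c ->
  (forall n, \sum_(k < n) h k <= b) ->
  nnsum (fun k => c * h k) = c * nnsum h.
Proof.
move=> c0 hb; apply/eqP; rewrite eq_le; apply/andP; split.
  apply: nnsum_le => n; rewrite -mulr_sumr ler_pM2l//; exact: le_nnsum hb.
rewrite -ler_pdivlMl//; apply: nnsum_le => n; rewrite ler_pdivlMl// mulr_sumr.
apply: (@le_nnsum _ _ (c * b)) => m; by rewrite -mulr_sumr ler_pM2l.
Qed.

Lemma nonincr_le (R : realType) (g : nat -> R) m n :
  (forall k, g k.+1 <= g k) -> (m <= n)%N -> g n <= g m.
Proof.
move=> gni /subnK <-; elim: (n - m)%N => // k IH.
exact: le_trans (gni _) IH.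
Qed.

(* The least nonincreasing majorant of the sequence [g] restricted to [P]. *)
Section Envelope.
Context {R : realType}.
Variables (P : pred nat) (g : nat -> R).
Hypotheses (g0 : forall k, 0 <= g k) (gni : forall k, g k.+1 <= g k).

(** The value 0 keeps the set nonempty and makes the envelope vanish beyond the last index of
    [P]. *)
Let candidates n := [set r | r = 0 \/ exists m, [/\ (n <= m)%N, P m & r = g m]].

Definition envelope n : R := sup (candidates n).

Let candidates_has_sup n : has_sup (candidates n).
Proof.
split; first by exists 0; left.
exists (g n) => r [->//|[m [nm _ ->]]]; exact: nonincr_le.
Qed.

Lemma envelope_le n b : 0 <= b ->
  (forall m, (n <= m)%N -> P m -> g m <= b) -> envelope n <= b.
Proof.
move=> b0 gb; apply: ge_sup; first by exists 0; left.
by move=> r [->//|[m [nm Pm ->]]]; exact: gb.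
Qed.

Lemma envelope_ge0 n : 0 <= envelope n.
Proof. by apply: sup_ubound; [case: (candidates_has_sup n)|left]. Qed.

Lemma le_envelope n m : (n <= m)%N -> P m -> g m <= envelope n.
Proof.
move=> nm Pm; apply: sup_ubound; first by case: (candidates_has_sup n).
by right; exists m.
Qed.

Lemma envelope_le_seq n : envelope n <= g n.
Proof. by apply: envelope_le => // m nm _; exact: nonincr_le. Qed.

Lemma envelope_nincr n : envelope n.+1 <= envelope n.
Proof.
by apply: envelope_le => [|m nm Pm]; [exact: envelope_ge0|exact/le_envelope/Pm/ltnW].
Qed.

(** Outside [P] the value [g n] is not a candidate, so the envelope is constant across the gaps of
    [P]. *)
Lemma envelope_skip n : ~~ P n -> envelope n <= envelope n.+1.
Proof.
move=> Pn; apply: envelope_le => [|m nm Pm]; first exact: envelope_ge0.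
apply: le_envelope => //; rewrite ltn_neqAle nm andbT.
by apply: contraNneq Pn => ->.
Qed.

End Envelope.

(** * Head and tail bounds for envelopes *)

Section SplitMajorization.
Context {R : realType}.
Variables (f g : nat -> R).
Hypotheses (f0 : forall k, 0 <= f k) (fni : forall k, f k.+1 <= f k).
Hypotheses (g0 : forall k, 0 <= g k) (gni : forall k, g k.+1 <= g k).
Variable H : pred nat.

(** Prefix averages decrease, because [f N] separates the first [N] terms from the later ones.
    Clearing denominators covers [N = 0]. *)
Lemma average_nincr N m : (N <= m)%N ->
  N%:R * \sum_(k < m) f k <= m%:R * \sum_(k < N) f k.
Proof.
move=> Nm; rewrite -!(big_mkord xpredT f) (big_cat_nat (leq0n _) Nm)//= mulrDr.
have -> : m%:R = N%:R + (m - N)%:R :> R by rewrite -natrD subnKC.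
rewrite mulrDl lerD2l.
apply: (@le_trans _ _ ((m - N)%:R * (N%:R * f N))).
  rewrite mulrCA ler_wpM2l// mulr_natl -sumr_const_nat.
  by apply: ler_sum_nat => k /andP[Nk _]; exact: nonincr_le.
rewrite ler_wpM2l// mulr_natl -[N in _ *+ N]subn0 -sumr_const_nat.
by apply: ler_sum_nat => k /andP[_ kN]; exact/nonincr_le/ltnW.
Qed.

(** One multiple [c] pays for the sum up to the last index of [H] before [N], the other for the
    constant stretch that follows it. *)
Lemma head_envelope_le (c : R) : 0 <= c ->
  (forall N, H N -> \sum_(k < N.+1) g k <= c * \sum_(k < N.+1) f k) ->
  forall N, \sum_(k < N) envelope H g k <= 2 * c * \sum_(k < N) f k.
Proof.
move=> c0 gf N; pose G := envelope H g.
have G0 n : 0 <= G n by exact: envelope_ge0.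
(* The term [n%:R * G n] absorbs the indices outside [H], where [G n <= G n.+1]; at an index of [H]
   the hypothesis restarts the bound. *)
have step n : \sum_(k < n) G k <= c * \sum_(k < n) f k + n%:R * G n.
  elim: n => [|n IH]; first by rewrite !big_ord0 mulr0 mul0r addr0.
  have [Hn|Hn] := boolP (H n).
    apply: (@le_trans _ _ (\sum_(k < n.+1) g k)).
      by apply: ler_sum => k _; exact: envelope_le_seq.
    by apply: le_trans (gf _ Hn) _; rewrite lerDl mulr_ge0.
  have Gn : G n <= G n.+1 by exact: envelope_skip.
  rewrite !big_ord_recr/= mulrDr -natr1 mulrDl mul1r.
  have := mulr_ge0 c0 (f0 n); have := ler_wpM2l (ler0n R n) Gn; lra.
(* For [m >= N] in [H], the value [g m] is at most the average of [g] over [m.+1] terms, hence at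
   most [c] times that of [f], which is no larger than the average over [N] terms. *)
have NG : N%:R * G N <= c * \sum_(k < N) f k.
  have [->|N0] := posnP N; first by rewrite big_ord0 mulr0 mul0r.
  have NR : 0 < N%:R :> R by rewrite ltr0n.
  rewrite mulrC -ler_pdivlMr//; apply: envelope_le.
    by rewrite divr_ge0 ?mulr_ge0 ?sumr_ge0.
  move=> m Nm Hm; rewrite ler_pdivlMr//.
  have m0 : 0 < m.+1%:R :> R by rewrite ltr0n.
  rewrite -(ler_pM2l m0).
  apply: (@le_trans _ _ (N%:R * \sum_(k < m.+1) g k)).
    rewrite mulrA [leLHS]mulrC ler_wpM2l// mulr_natl.
    rewrite -[X in _ *+ X]subn0 -sumr_const_nat -[leRHS](big_mkord xpredT g).
    by apply: ler_sum_nat => k /andP[_ km]; exact: nonincr_le.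
  apply: (@le_trans _ _ (N%:R * (c * \sum_(k < m.+1) f k))).
    by rewrite ler_wpM2l ?gf.
  rewrite mulrCA [leRHS]mulrCA ler_wpM2l//; exact/average_nincr/leqW.
have := step N; lra.
Qed.

(** Let [m] be the first index of [H] from [N] on. Up to [m] the envelope is at most [g m], which
    costs [m.+1%:R * g m ^ q]; beyond [m] it is at most [g]. Each part is at most [L * W f m.+1],
    and [W f] decreases. *)
Lemma tail_envelope_le (q L bf bg : R) : 0 < q -> 0 <= L ->
  (forall n, \sum_(k < n) f k `^ q <= bf) ->
  (forall n, \sum_(k < n) g k `^ q <= bg) ->
  let W (h : nat -> R) := tail (fun k => h k `^ q) in
  (forall N, H N -> W g N.+1 <= L * W f N.+1
     /\ N.+1%:R * g N `^ q <= L * W f N.+1) ->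
  forall N, W (envelope H g) N <= 2 * L * W f N.
Proof.
move=> q0 L0 fb gb W gf N.
have pow_le u v : 0 <= u -> u <= v -> u `^ q <= v `^ q.
  by move=> u0 uv; apply: (ge0_ler_powR (ltW q0)); rewrite ?nnegrE ?(le_trans u0).
have G0 n : 0 <= envelope H g n by exact: envelope_ge0.
have Wf0 n : 0 <= W f n by exact: tail_ge0 fb.
apply: tail_le => [k|M NM]; first exact: powR_ge0.
have sumG n m : \sum_(n <= k < m) envelope H g k `^ q <=
                \sum_(n <= k < m) g k `^ q.
  by apply: ler_sum_nat => k _; apply: pow_le => //; exact: envelope_le_seq.
have [|noH] := pselect (exists m, (N <= m)%N && H m); last first.
  rewrite big1_seq ?mulr_ge0// => k /andP[_]; rewrite mem_index_iota => /andP[Nk _].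
  suff -> : envelope H g k = 0 by rewrite powR0 ?gt_eqF.
  apply/eqP; rewrite eq_le G0 andbT; apply: envelope_le => // m km Hm.
  by case: noH; exists m; rewrite Hm (leq_trans Nk).
move=> /ex_minnP[m /andP[Nm Hm] minm].
have [gW gm] := gf _ Hm.
(* The block is enlarged so that it reaches past [m] and can be cut there. *)
have bigM : \sum_(N <= k < maxn m.+1 M) envelope H g k `^ q <= 2 * L * W f m.+1.
  rewrite (@big_cat_nat _ _ _ m.+1) ?leq_maxl ?leqW//=.
  apply: (@le_trans _ _ (m.+1%:R * g m `^ q + W g m.+1)); last lra.
  apply: lerD; last first.
    by apply: le_trans (sumG _ _) _; apply: le_tail gb _; rewrite leq_maxl.
  apply: (@le_trans _ _ (\sum_(N <= k < m.+1) g m `^ q)).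
    apply: ler_sum_nat => k /andP[Nk _]; apply: pow_le => //.
    apply: envelope_le => // j kj Hj; apply: nonincr_le => //.
    by apply: minm; rewrite Hj (leq_trans Nk).
  by rewrite sumr_const_nat mulr_natl ler_wpMn2l ?powR_ge0 ?leq_subr.
apply: (@le_trans _ _ (\sum_(N <= k < maxn m.+1 M) envelope H g k `^ q)).
  rewrite [leRHS](@big_cat_nat _ _ _ M) ?leq_maxr//= lerDl sumr_ge0// => k _.
  exact: powR_ge0.
apply: le_trans bigM _; rewrite ler_wpM2l ?mulr_ge0// tail_nincr ?leqW// => k.
exact: powR_ge0.
Qed.

End SplitMajorization.

(** * Majorization by a triangular matrix *)

(** Only comparisons free of nested conditionals are split, so that minima and maxima are resolved
    from the inside out. *)
Ltac min_max_cases := rewrite /Order.min /Order.max;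
  repeat match goal with
  | |- context [if ?a < ?b then _ else _] =>
    lazymatch a with context [if _ then _ else _] => fail | _ =>
    lazymatch b with context [if _ then _ else _] => fail | _ =>
      case: (ltP a b) => ?
    end end
  end; try lra.

Section TriangularTransport.
Context {R : realType}.
Variables (f g : nat -> R).
Hypotheses (f0 : forall k, 0 <= f k) (g0 : forall k, 0 <= g k).
Hypothesis gni : forall k, g k.+1 <= g k.
Hypothesis gf : forall N : nat, \sum_(k < N) g k <= \sum_(k < N) f k.

(** Deficits and surpluses are laid end to end as two families of consecutive intervals starting at
    0; the overlap of two intervals is the mass moved from [j] to [i]. *)
Let deficit k := Num.max 0 (g k - f k).
Let surplus k := Num.max 0 (f k - g k).
Let D n := \sum_(k < n) deficit k.
Let S n := \sum_(k < n) surplus k.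
Let clamp (a b x : R) := Num.min b (Num.max a x).

(* The length of the intersection of the intervals [D i, D i.+1] and
   [S j, S j.+1]. *)
Let overlap i j := clamp (D i) (D i.+1) (S j.+1) - clamp (D i) (D i.+1) (S j).

(** Both sides are the length of the intersection of [[a, b]] and [[c, d]]; exchanging the roles
    makes column sums telescope. *)
Let clampC a b c d : a <= b -> c <= d ->
  clamp a b d - clamp a b c = clamp c d b - clamp c d a.
Proof.
rewrite /clamp => ab cd.
by case: (leP a c) => ac; case: (leP b d) => bd; case: (leP a d) => ad;
  case: (leP b c) => bc; try lra; min_max_cases.
Qed.

Let clamp_homo a b x y : x <= y -> clamp a b x <= clamp a b y.
Proof.
by rewrite /clamp => xy; min_max_cases.
Qed.

Let deficit_ge0 k : 0 <= deficit k. Proof. by rewrite le_max lexx. Qed.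
Let surplus_ge0 k : 0 <= surplus k. Proof. by rewrite le_max lexx. Qed.

Let DS n : D n <= S n.
Proof.
rewrite -subr_ge0 /S /D -sumrB.
rewrite (eq_bigr (fun k : 'I_n => f k - g k)) => [|k _].
  by rewrite sumrB subr_ge0 gf.
by rewrite /surplus /deficit; min_max_cases.
Qed.

Let D_nd n : D n <= D n.+1. Proof. by rewrite /D big_ord_recr/= lerDl. Qed.
Let S_nd n : S n <= S n.+1. Proof. by rewrite /S big_ord_recr/= lerDl. Qed.

(* At most one of the two summands of [f i - g i] is nonzero. *)
Let DSS i : D i.+1 <= S i.
Proof.
have [d0|d0] := eqVneq (deficit i) 0.
  by rewrite /D big_ord_recr/= d0 addr0 DS.
have s0 : surplus i = 0.
  by move: d0; rewrite /surplus /deficit; min_max_cases; rewrite eqxx.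
by have := DS i.+1; rewrite /S big_ord_recr/= s0 addr0.
Qed.

Let overlap_ge0 i j : 0 <= overlap i j.
Proof. by rewrite subr_ge0 clamp_homo. Qed.

(** By [DSS] the interval [[D i, D i.+1]] lies in [[0, S i]], which the surplus intervals with
    [j < i] tile. *)
Let overlap_row i : \sum_(j < i) overlap i j = deficit i.
Proof.
rewrite -(big_mkord xpredT (overlap i)) telescope_sumr//.
have S0 : S 0 = 0 by rewrite /S big_ord0.
have D0 : 0 <= D i by rewrite sumr_ge0.
have DE : D i.+1 = D i + deficit i by rewrite /D big_ord_recr.
have := deficit_ge0 i; have := DSS i; rewrite S0 DE /clamp; min_max_cases.
Qed.

Let overlap_col n j : \sum_(i < n) overlap i j <= surplus j.
Proof.
have -> : \sum_(i < n) overlap i j =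
    \sum_(0 <= i < n) (clamp (S j) (S j.+1) (D i.+1) - clamp (S j) (S j.+1) (D i)).
  by rewrite big_mkord; apply: eq_bigr => i _; exact: clampC.
rewrite telescope_sumr// -(addKr (S j) (surplus j)).
have -> : S j + surplus j = S j.+1 by rewrite /S big_ord_recr.
by have := S_nd j; rewrite /clamp; min_max_cases.
Qed.

Let overlap_neq0 i j : overlap i j != 0 -> g j < f j.
Proof.
apply: contraNT; rewrite -leNgt => fg.
have s0 : surplus j = 0 by apply/max_idPl; rewrite subr_le0.
by rewrite /overlap {1}/S big_ord_recr/= s0 addr0 subrr.
Qed.

(** If [f k = 0] and [g k <= f k], then [g k = 0] and the quotient is 0 by the convention for
    inverses. *)
Let diag k := if g k <= f k then g k / f k else 1.

(* The diagonal transports as much of [f k] as possible to [g k]; the remaining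
   deficits are covered by earlier surpluses. A surplus at [j < i] has
   [f j > g j >= g i], which bounds the row sums. *)
Lemma triangular_transport : exists T : nat -> nat -> R,
  [/\ forall i j, 0 <= T i j,
      forall i, \sum_(j < i.+1) T i j <= 2,
      forall i j, (i < j)%N -> T i j = 0,
      forall n j, \sum_(i < n) T i j <= 1
    & forall i, \sum_(j < i.+1) T i j * f j = g i].
Proof.
have dg0 k : 0 <= diag k by rewrite /diag; case: ifP => // _; rewrite divr_ge0.
have dg1 k : diag k <= 1.
  rewrite /diag; case: ifPn => // gfk; have := f0 k; rewrite le_eqVlt => /predU1P[<-|fk].
    by rewrite invr0 mulr0.
  by rewrite ler_pdivrMr// mul1r.
exists (fun i j => if (j < i)%N then overlap i j / f j else (i == j)%:R * diag i).
have sumE i (h : nat -> R) :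
  \sum_(j < i.+1) (if (j < i)%N then overlap i j / f j else (i == j :> nat)%:R * diag i) * h j
  = \sum_(j < i) overlap i j / f j * h j + diag i * h i.
  rewrite big_ord_recr/= ltnn eqxx mul1r; congr +%R.
  by apply: eq_bigr => j _; rewrite ltn_ord.
split.
- move=> i j; case: ifP => _; first by rewrite divr_ge0.
  by rewrite mulr_ge0.
- move=> i; have := sumE i (fun=> 1).
  under eq_bigr do rewrite mulr1; move=> ->.
  under eq_bigr do rewrite mulr1; rewrite mulr1.
  (* The diagonal entry takes at most 1 of the row bound 2; the rest is at most
     [deficit i / g i <= 1], with [g i = 0] treated apart. *)
  suff : \sum_(j < i) overlap i j / f j <= 1 by have := dg1 i; lra.
  have := g0 i; rewrite le_eqVlt => /predU1P[gi|gi].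
    have di : deficit i = 0.
      by apply/max_idPl; rewrite -gi sub0r oppr_le0.
    rewrite big1 ?ler01// => j _; apply/eqP; rewrite mulf_eq0; apply/orP; left.
    by apply/eqP; move: j {+}isT; apply: psumr_eq0P => //; rewrite overlap_row.
  apply: (@le_trans _ _ (\sum_(j < i) overlap i j / g i)).
    apply: ler_sum => j _; have [->|ov] := eqVneq (overlap i j) 0.
      by rewrite !mul0r.
    rewrite ler_wpM2l// lef_pV2 ?posrE//.
      by apply: le_trans (ltW (overlap_neq0 ov)); exact/nonincr_le/ltnW.
    by apply: le_lt_trans (overlap_neq0 ov).
  rewrite -mulr_suml overlap_row ler_pdivrMr// mul1r /deficit ge_max g0/=.
  by rewrite gerBl.
- by move=> i j ij; rewrite ltnNge (ltnW ij)/= ltn_eqF// mul0r.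
- move=> n j.
  apply: (@le_trans _ _ (\sum_(i < n) overlap i j / f j + diag j)).
    apply: (@le_trans _ _ (\sum_(i < n) (overlap i j / f j + (i == j :> nat)%:R * diag j))).
      apply: ler_sum => i _; case: ifP => _; first by rewrite lerDl mulr_ge0.
      case: eqP => [->|_]; first by rewrite lerDr divr_ge0.
      by rewrite !mul0r addr0 divr_ge0.
    rewrite big_split/= lerD2l -mulr_suml ler_piMl//.
    suff -> : \sum_(i < n) (i == j :> nat)%:R = (j < n)%:R :> R.
      by rewrite lern1; case: (j < n)%N.
    elim: n => [|n IH]; first by rewrite big_ord0.
    rewrite big_ord_recr/= IH ltnS [n == j]eq_sym.
    by case: (ltngtP j n) => /= _; rewrite ?addr0 ?add0r.
  rewrite -mulr_suml; have := overlap_col n j.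
  have := f0 j; rewrite le_eqVlt => /predU1P[<-|fj].
    by rewrite invr0 mulr0 add0r.
  (* Either [g j <= f j], and the two fractions add up to 1, or the surplus is 0 and the diagonal
     entry is 1. *)
  move=> ov; apply: (@le_trans _ _ (surplus j / f j + diag j)).
    by rewrite lerD2r ler_wpM2r// invr_ge0 ltW.
  rewrite /surplus /diag; case: ifPn => [gfj|].
    by rewrite max_r ?subr_ge0// -mulrDl subrK divff ?gt_eqF.
  by rewrite -ltNge => /ltW fg; rewrite max_l ?subr_le0// mul0r add0r.
- move=> i; rewrite sumE (eq_bigr (fun j : 'I_i => overlap i j)) => [|j _].
    rewrite overlap_row /deficit /diag; case: ifPn => [gfi|]; last first.
      by rewrite -ltNge mul1r => fg; rewrite max_r ?subrK// subr_ge0 ltW.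
    rewrite max_l ?subr_le0// add0r; have [fi|fi] := eqVneq (f i) 0; last first.
      by rewrite divfK.
    by apply/esym/eqP; rewrite fi mulr0 eq_le g0 -fi gfi.
  have [->|ov] := eqVneq (overlap i j) 0; first by rewrite !mul0r.
  rewrite divfK// gt_eqF//; exact: le_lt_trans (overlap_neq0 ov).
Qed.

End TriangularTransport.

(** * Nonincreasing rearrangement *)

(** The images are distinct, so they all lie below some [m] without repetition. This keeps
    rearrangement arguments within finite sums. *)
Lemma sum_inj_le (R : realType) (h : nat -> R) (P : pred nat) (p : nat -> nat) n :
  (forall k, 0 <= h k) -> {in P &, injective p} ->
  exists m : nat, \sum_(k < n | P k) h (p k) <= \sum_(k < m) h k.
Proof.
move=> h0 pinj; pose s := [seq p k | k <- iota 0 n & P k].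
have us : uniq s.
  rewrite map_inj_in_uniq ?filter_uniq ?iota_uniq// => i j.
  by rewrite !mem_filter => /andP[Pi _] /andP[Pj _]; exact: pinj.
pose m := (\max_(k <- s) k).+1; exists m.
have sm : {subset s <= iota 0 m}.
  by move=> k ks; rewrite mem_iota/= ltnS (@leq_bigmax_seq _ s xpredT id k).
have -> : \sum_(k < n | P k) h (p k) = \sum_(k <- s) h k.
  by rewrite big_map big_filter -(big_mkord P (fun k => h (p k))) /index_iota subn0.
rewrite -(big_mkord xpredT h) /index_iota subn0.
rewrite [leRHS](bigID (mem s))/= -[X in X + _]big_filter.
have -> : \sum_(k <- s) h k = \sum_(k <- [seq k <- iota 0 m | k \in s]) h k.
  apply: perm_big; apply: uniq_perm => //; first by rewrite filter_uniq ?iota_uniq.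
  by move=> k; rewrite mem_filter; case: (boolP (k \in s)) => //= /sm ->.
by rewrite lerDl sumr_ge0.
Qed.

(** * Decreasing enumeration of a summable sequence *)

Section Enumeration.
Context {R : realType}.
Variables (h : nat -> R) (b : R).
Hypotheses (h0 : forall k, 0 <= h k) (hb : forall n, \sum_(k < n) h k <= b).

Lemma finitely_many_ge e : 0 < e -> exists m, forall k, (m <= k)%N -> h k < e.
Proof.
move=> e0.
have cvgh : cvgn (series h).
  apply: nnseries_is_cvg => //.
  by rewrite (nneseries_nnsum h0 hb) ltry.
have /cvgrPdist_lt/(_ e e0)[m _ hm] := cvg_series_cvg_0 cvgh.
by exists m => k /hm /=; rewrite sub0r normrN ger0_norm.
Qed.

(** If some [h j > 0] remains outside [s], only finitely many indices reach the value [h j], and a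
    maximum over finitely many indices suffices. Otherwise any index outside [s] will do. *)
Lemma fresh_max (s : seq nat) :
  exists k, k \notin s /\ forall j, j \notin s -> h j <= h k.
Proof.
have [[j [js hj]]|none] := pselect (exists j, j \notin s /\ 0 < h j); last first.
  have ks : (\max_(k <- s) k).+1 \notin s.
    by apply/negP => /(@leq_bigmax_seq _ _ xpredT id)-/(_ isT); rewrite ltnn.
  exists (\max_(k <- s) k).+1; split=> // j js; apply: le_trans (h0 _).
  by rewrite leNgt; apply/negP => hj; apply: none; exists j.
have [m hm] := finitely_many_ge hj.
have jm : (j < m)%N by rewrite ltnNge; apply/negP => /hm; rewrite ltxx.
have := @arg_maxP _ _ _ (Ordinal jm) (fun k : 'I_m => val k \notin s)
  (fun k : 'I_m => h k) js.
case=> k ks kmax; exists (val k); split => // i i_s.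
have [im|/hm/ltW] := ltnP i m; first exact: (kmax (Ordinal im)).
by move=> /le_trans; apply; exact: (kmax (Ordinal jm)).
Qed.

(** Greedy choice of a largest term not yet taken. An index never chosen, with [h k > 0], would lie
    below every chosen term, so [n * h k <= b] for all [n]. Zeros of [h] may be skipped. *)
Lemma decreasing_enumeration : exists sigma : nat -> nat,
  [/\ injective sigma, forall n, h (sigma n.+1) <= h (sigma n)
    & forall k, h k != 0 -> exists n, sigma n = k].
Proof.
pose pick s := projT1 (cid (fresh_max s)).
have pick_fresh s : pick s \notin s by rewrite /pick; case: cid => k [].
have pick_max s j : j \notin s -> h j <= h (pick s).
  by rewrite /pick; case: cid => k [_] /= + js; apply.
pose L := fix L n := if n is n'.+1 then pick (L n') :: L n' else [::].
pose sigma n := pick (L n).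
have Lsigma m n : (m < n)%N -> sigma m \in L n.
  elim: n => // n IH; rewrite ltnS leq_eqVlt => /predU1P[->|/IH].
    by rewrite mem_head.
  by move=> mn; rewrite inE mn orbT.
have Linv n k : k \in L n -> exists m, sigma m = k.
  by elim: n => // n IH; rewrite inE => /predU1P[->|/IH//]; exists n.
have sigma_neq m n : (m < n)%N -> sigma m != sigma n.
  move=> /Lsigma mn; apply: contraNneq (pick_fresh (L n)) => e.
  by rewrite -[pick _]/(sigma n) -e.
have sigma_inj : injective sigma.
  move=> m n mn; have [|| //] := ltngtP m n => /sigma_neq; by rewrite mn eqxx.
exists sigma; split => //.
- move=> n; apply: pick_max; have := pick_fresh (L n.+1).
  by rewrite inE negb_or => /andP[].
- move=> k hk; apply: contrapT => nok.
  have kL n : k \notin L n by apply/negP => /Linv.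
  have hk0 : 0 < h k by rewrite lt_neqAle eq_sym hk h0.
  have bnd n : n%:R * h k <= b.
    have [m sm] := @sum_inj_le R h xpredT sigma n h0 (in2W sigma_inj).
    apply: le_trans (hb m); apply: le_trans sm.
    rewrite -[n in n%:R]card_ord mulr_natl -sumr_const.
    by apply: ler_sum => i _; exact: pick_max.
  have := bnd (Num.bound `|b / h k|).+1; rewrite leNgt => /negP; apply.
  rewrite -ltr_pdivrMr//; apply: le_lt_trans (ler_norm _) _.
  by apply: lt_le_trans (archi_boundP (normr_ge0 _)) _; rewrite ler_nat.
Qed.

End Enumeration.

Section Rearrangement.
Context {R : realType} {F : scalars R}.

(** The indices with modulus above [l] form an initial segment, which has at most [n] elements
    exactly when index [n], counted from 0, is outside it. *)
Lemma rearr_nincr (x : nat -> F) n : 0 <= modulus (x n) ->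
  (forall k, modulus (x k.+1) <= modulus (x k)) ->
  rearr x n = modulus (x n).
Proof.
move=> x0 xni; rewrite /rearr.
suff -> : [set l : R | 0 <= l /\ ([set k | (l < modulus (x k))%R] #<= `I_n)%card] =
          [set l | modulus (x n) <= l].
  apply/eqP; rewrite eq_le; apply/andP; split.
    by apply: ge_inf => /=; [exists (modulus (x n)) => l /=|].
  by apply: lb_le_inf => [|l]//; exists (modulus (x n)) => /=.
apply/seteqP; split => l /=.
- move=> [l0 card]; rewrite leNgt; apply/negP => lx.
  have : (`I_n.+1 #<= `I_n)%card.
    apply: card_le_trans card; apply: subset_card_le => k /= kn.
    by apply: lt_le_trans lx _; exact: (nonincr_le (g := fun k => modulus (x k))).
  by rewrite card_le_II ltnn.
- move=> xl; split; first exact: le_trans xl.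
  apply: subset_card_le => k /=; rewrite ltNge => /negP lk; rewrite ltnNge.
  apply/negP => nk; apply: lk; apply: le_trans xl.
  exact: (nonincr_le (g := fun k => modulus (x k))).
Qed.

End Rearrangement.

(** * Estimates for the K-functional *)

Lemma powR_le (R : realType) (p x y : R) :
  0 <= p -> 0 <= x -> x <= y -> x `^ p <= y `^ p.
Proof.
by move=> p0 x0 xy; apply: (ge0_ler_powR p0); rewrite ?nnegrE ?(le_trans x0).
Qed.

Lemma powRD_le (R : realType) (p x y : R) : 0 <= p -> 0 <= x -> 0 <= y ->
  (x + y) `^ p <= 2 `^ p * (x `^ p + y `^ p).
Proof.
move=> p0 x0 y0.
have px := powR_ge0 x p; have py := powR_ge0 y p.
apply: (@le_trans _ _ ((2 * Num.max x y) `^ p)).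
  apply: powR_le; rewrite ?addr_ge0//.
  by rewrite /Order.max; case: ltP => ?; lra.
rewrite powRM ?le_max ?x0// ler_wpM2l ?powR_ge0// /Order.max.
by case: ltP => _; rewrite ?lerDl ?lerDr.
Qed.

(** Dropping at most [N] terms removes no more than dropping the [N] largest. With pivot [h N], the
    products of [(P k)%:R - (N <= k)%N%:R] and [h k - h N] are all nonnegative. *)
Lemma sum_dropped_le (R : realType) (h : nat -> R) (P : pred nat) N M :
  (forall k, 0 <= h k) -> (forall k, h k.+1 <= h k) -> (N <= M)%N ->
  \sum_(k < M) (~~ P k)%:R <= N%:R :> R ->
  \sum_(N <= k < M) h k <= \sum_(k < M | P k) h k.
Proof.
move=> h0 hni NM card.
have -> : \sum_(N <= k < M) h k = \sum_(k < M) (N <= k)%N%:R * h k.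
  rewrite -(big_mkord xpredT (fun k => (N <= k)%N%:R * h k)).
  rewrite (big_cat_nat (leq0n _) NM)/= [X in _ = X + _]big1_seq ?add0r; last first.
    by move=> k; rewrite mem_index_iota /= => kN; rewrite leqNgt kN mul0r.
  by apply: eq_big_nat => k /andP[-> _]; rewrite mul1r.
have -> : \sum_(k < M | P k) h k = \sum_(k < M) (P k)%:R * h k.
  by rewrite big_mkcond; apply: eq_bigr => k _; case: (P k); rewrite ?mul1r ?mul0r.
rewrite -subr_ge0 -sumrB.
have cnt : \sum_(k < M) (N <= k)%N%:R <= \sum_(k < M) (P k)%:R :> R.
  have -> : \sum_(k < M) (P k)%:R = M%:R - \sum_(k < M) (~~ P k)%:R :> R.
    rewrite -[M in M%:R]card_ord -sumr_const -sumrB.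
    by apply: eq_bigr => k _; case: (P k); rewrite ?subr0 ?subrr.
  have -> : \sum_(k < M) (N <= k)%N%:R = M%:R - N%:R :> R.
    rewrite -(big_mkord xpredT (fun k => (N <= k)%N%:R)).
    rewrite (big_cat_nat (leq0n _) NM)/= [X in X + _ = _]big1_seq ?add0r; last first.
      by move=> k; rewrite mem_index_iota /= => kN; rewrite leqNgt kN.
    rewrite -natrB// -sumr_const_nat.
    by apply: eq_big_nat => k /andP[-> _].
  lra.
have : 0 <= \sum_(k < M) ((P k)%:R - (N <= k)%N%:R) * (h k - h N).
  apply: sumr_ge0 => k _; have [Nk|/ltnW kN] := leqP N k.
    have hk : h k <= h N by exact: nonincr_le.
    by case: (P k); rewrite /= ?subrr ?mul0r// sub0r mulN1r oppr_ge0 subr_le0.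
  by rewrite subr0 mulr_ge0// subr_ge0; exact: nonincr_le.
have := ler_wpM2r (h0 N) cnt.
rewrite -(subr_ge0 (_ * _)) -mulrBl -sumrB mulr_suml => c1 c2.
apply: le_trans (addr_ge0 c1 c2) _; rewrite -big_split/=.
by apply: ler_sum => k _; lra.
Qed.

Section KfunctionalEstimates.
Context {R : realType}.
Variables (q : R) (N : nat).
Hypotheses (q1 : 1 < q) (N0 : (0 < N)%N).

(** At this [t] the norms balance on the indicator of [N] indices: [N = t * N ^ (1/q)]. *)
Let t : R := N%:R `^ (1 - q^-1).

Let q0 : 0 < q. Proof. by rewrite (lt_trans ltr01). Qed.
Let NR : 0 < N%:R :> R. Proof. by rewrite ltr0n. Qed.
Let t0 : 0 < t. Proof. exact: powR_gt0. Qed.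

Let tq : t `^ q = N%:R `^ (q - 1).
Proof. by rewrite -powRrM mulrBl mul1r mulVf ?gt_eqF. Qed.

(** Hölder's inequality up to the factor 2: terms below the threshold [mu] add up to at most
    [N * mu = t * b], and the others satisfy [v <= v^q / mu^(q-1)]. *)
Lemma sum_lq_le (v : nat -> R) b : 0 <= b -> (forall k, 0 <= v k) ->
  \sum_(k < N) v k `^ q <= b `^ q -> \sum_(k < N) v k <= 2 * (t * b).
Proof.
rewrite le_eqVlt => /predU1P[<-|b0] v0 vb.
  have vq0 : \sum_(k < N) v k `^ q = 0.
    apply/eqP; rewrite eq_le; apply/andP; split.
      by apply: le_trans vb _; rewrite powR0 ?gt_eqF.
    by apply: sumr_ge0 => k _; exact: powR_ge0.
  rewrite big1 ?mulr0// => k _; apply: (@powR_eq0_eq0 _ _ q).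
  have /psumr_eq0P := vq0; apply=> // i _; exact: powR_ge0.
pose mu := b * N%:R `^ (- q^-1).
have mu0 : 0 < mu by rewrite mulr_gt0 ?powR_gt0.
have Nmu : N%:R * mu = t * b.
  rewrite /mu mulrCA [RHS]mulrC /t powRD; last by rewrite (gt_eqF NR) implybT.
  by rewrite powRr1 ?ltW.
have bmu : b `^ q = N%:R * mu `^ q.
  rewrite /mu powRM ?powR_ge0 ?ltW// -powRrM mulNr mulVf ?gt_eqF//.
  by rewrite mulrCA powR_inv1 ?ltW// divff ?gt_eqF ?mulr1.
apply: (@le_trans _ _ (\sum_(k < N) (mu + v k `^ q / mu `^ (q - 1)))).
  apply: ler_sum => k _; have [vm|/ltW mv] := leP (v k) mu.
    by rewrite -[leLHS]addr0 lerD// divr_ge0 ?powR_ge0.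
  rewrite -[leLHS]add0r lerD ?(ltW mu0)// ler_pdivlMr ?powR_gt0//.
  rewrite -(mulr_powRB1 (v0 k) q0) ler_wpM2l// powR_le ?(ltW mu0)//.
  by rewrite subr_ge0 ltW.
rewrite big_split/= sumr_const card_ord -[mu *+ N]mulr_natl Nmu -mulr_suml.
suff : (\sum_(k < N) v k `^ q) / mu `^ (q - 1) <= t * b by lra.
rewrite ler_pdivrMr ?powR_gt0// (le_trans vb)// bmu -Nmu -mulrA.
by rewrite (mulr_powRB1 (ltW mu0) q0).
Qed.

Variables (g u v : nat -> R) (a b : R).
Hypotheses (g0 : forall k, 0 <= g k) (gni : forall k, g k.+1 <= g k).
Hypotheses (u0 : forall k, 0 <= u k) (v0 : forall k, 0 <= v k).
Hypothesis guv : forall k, g k <= u k + v k.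
Hypotheses (a0 : 0 <= a) (b0 : 0 <= b).
Hypothesis ua : forall n : nat, \sum_(k < n) u k <= a.
Hypothesis vb : forall n : nat, \sum_(k < n) v k `^ q <= b `^ q.

Lemma decomposition_head_le : \sum_(k < N) g k <= 4 * (a + t * b).
Proof.
apply: (@le_trans _ _ (\sum_(k < N) (u k + v k))).
  by apply: ler_sum => k _; exact: guv.
rewrite big_split/=.
have := sum_lq_le b0 v0 (vb N); have := ua N.
by have := a0; have := mulr_ge0 (ltW t0) b0; lra.
Qed.

(* Off the set where [u] exceeds [a / N], which has at most [N] elements,
   [u^q] is at most [(a / N)^(q - 1) * u]. *)
Lemma decomposition_tail_le M : (N <= M)%N ->
  t * (\sum_(N <= k < M) g k `^ q) `^ q^-1 <= 4 * (a + t * b).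
Proof.
move=> NM; pose P k := u k <= a / N%:R.
(* Chebyshev's inequality for [u]; [a = 0] is separate because the threshold is then 0. *)
have card : \sum_(k < M) (~~ P k)%:R <= N%:R :> R.
  have [a_eq0|an0] := eqVneq a 0.
    rewrite big1 ?ltW// => k _; suff -> : P k by [].
    rewrite /P a_eq0 mul0r -a_eq0; apply: le_trans (ua k.+1).
    by rewrite big_ord_recr/= lerDr sumr_ge0.
  have ap : 0 < a by rewrite lt_neqAle eq_sym an0.
  rewrite -(ler_pM2r (divr_gt0 ap NR)) [leRHS]mulrCA divff ?gt_eqF// mulr1 mulr_suml.
  apply: le_trans (ua M); apply: ler_sum => k _.
  rewrite /P -ltNge; case: ltP => [/ltW|_]; first by rewrite mul1r.
  by rewrite mul0r.
have gq0 k : 0 <= g k `^ q by exact: powR_ge0.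
have gqni k : g k.+1 `^ q <= g k `^ q by apply: powR_le => //; exact: ltW.
have := sum_dropped_le gq0 gqni NM card.
set Sg := \sum_(N <= k < M) g k `^ q; set SP := \sum_(k < M | P k) _.
move=> SgP.
have Sg0 : 0 <= Sg by exact: sumr_ge0.
(* Chosen so that [t * c = a + t * b]. *)
pose c := a / t + b.
have c0 : 0 <= c by rewrite addr_ge0 ?divr_ge0// ltW.
have SPc : SP <= (4 * c) `^ q.
  apply: (@le_trans _ _ (\sum_(k < M) 2 `^ q * (u k * (a / N%:R) `^ (q - 1) + v k `^ q))).
    rewrite /SP big_mkcond; apply: ler_sum => k _; case: ifPn => [Pk|_]; last first.
      by rewrite mulr_ge0 ?addr_ge0 ?mulr_ge0 ?powR_ge0.
    apply: (@le_trans _ _ ((u k + v k) `^ q)); first by apply: powR_le => //; exact: ltW.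
    apply: le_trans (powRD_le _ _ _) _ => //; first exact: ltW.
    rewrite ler_wpM2l ?powR_ge0// lerD2r -(mulr_powRB1 (u0 k) q0) ler_wpM2l//.
    by rewrite powR_le// subr_ge0 ltW.
  rewrite -mulr_sumr big_split/= -mulr_suml.
  apply: (@le_trans _ _ (2 `^ q * ((a / t) `^ q + b `^ q))).
    rewrite ler_wpM2l ?powR_ge0// lerD ?vb//.
    apply: (@le_trans _ _ (a * (a / N%:R) `^ (q - 1))).
      by rewrite ler_wpM2r ?powR_ge0 ?ua.
    (* Since [t^q = N^(q-1)], the product [a * (a/N)^(q-1)] equals [(a/t)^q]. *)
    rewrite !powRM ?invr_ge0 ?(ltW t0) ?(ltW NR)// mulrA mulr_powRB1//.
    rewrite ler_wpM2l ?powR_ge0// -!powR_inv1 ?(ltW t0) ?(ltW NR)//.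
    by rewrite [leRHS]powRAC tq -!powRrM mulN1r mulrN1.
  (* One factor 2 comes from [powRD_le], the other from [2 * c^q <= (2 * c)^q]. *)
  have -> : 4 * c = 2 * (2 * c) by ring.
  rewrite [leRHS]powRM ?mulr_ge0// ler_wpM2l ?powR_ge0// [leRHS]powRM//.
  have c1 : (a / t) `^ q <= c `^ q.
    by apply: powR_le; rewrite ?divr_ge0 ?lerDl// ltW.
  have c2 : b `^ q <= c `^ q by apply: powR_le; rewrite ?lerDr ?divr_ge0// ltW.
  apply: (@le_trans _ _ (2 * c `^ q)); first lra.
  by rewrite ler_wpM2r ?powR_ge0// le1r_powR ?ler1n// ltW.
have : Sg `^ q^-1 <= 4 * c.
  apply: (@le_trans _ _ (((4 * c) `^ q) `^ q^-1)).
    by apply: powR_le => //; [rewrite invr_ge0 ltW|exact: le_trans SgP _].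
  by rewrite -powRrM divff ?gt_eqF// powRr1// mulr_ge0.
rewrite -(ler_pM2l t0) => /le_trans; apply.
by rewrite mulrCA /c mulrDr mulrCA divff ?gt_eqF// mulr1.
Qed.

End KfunctionalEstimates.

(** Combining [8 * Af < Ag] with the upper bound on [Ag] gives [Af < t * Wf^(1/q)]. The head is thus
    absorbed, and every bound becomes [8 * t * Wf^(1/q)]. *)
Lemma head_tail_dichotomy (R : realType) (q : R) (N : nat)
    (Af Ag Wf Wg gN : R) :
  1 < q -> (0 < N)%N -> 0 <= Wf -> 0 <= Wg -> 0 <= gN -> 
  let t := N%:R `^ (1 - q^-1) in
  N%:R * gN <= Ag -> Ag <= 4 * (Af + t * Wf `^ q^-1) ->
  t * Wg `^ q^-1 <= 4 * (Af + t * Wf `^ q^-1) ->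
  8 * Af < Ag ->
  Wg <= 8 `^ q * Wf /\ N%:R * gN `^ q <= 8 `^ q * Wf.
Proof.
move=> q1 N0 Wf0 Wg0 gN0 t gA Agle Wgle AfAg.
have q0 : 0 < q by lra.
have NR : 0 < N%:R :> R by rewrite ltr0n.
have t0 : 0 < t by exact: powR_gt0.
have rootK (x : R) : 0 <= x -> (x `^ q^-1) `^ q = x.
  by move=> x0; rewrite -powRrM mulVf ?gt_eqF// powRr1.
have W8 : 8 `^ q * Wf = (8 * Wf `^ q^-1) `^ q.
  by rewrite powRM ?powR_ge0// rootK.
rewrite W8; split.
  rewrite -[leLHS]rootK//; apply: powR_le; rewrite ?powR_ge0 ?(ltW q0)//.
  by rewrite -(ler_pM2l t0); lra.
have gle : N%:R * gN <= t * (8 * Wf `^ q^-1) by lra.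
have : (N%:R * gN) `^ q <= (t * (8 * Wf `^ q^-1)) `^ q.
  by apply: powR_le => //; [exact: ltW|rewrite mulr_ge0].
rewrite [X in X <= _]powRM// [leRHS]powRM ?mulr_ge0 ?powR_ge0 ?(ltW t0)//.
have -> : t `^ q = N%:R `^ (q - 1).
  by rewrite -powRrM mulrBl mul1r mulVf ?gt_eqF.
rewrite -(mulr_powRB1 (ltW NR) q0) mulrAC [leRHS]mulrC ler_pM2r ?powR_gt0//.
Qed.

(** * Contractions of sequence spaces *)

Section Contractions.
Context {R : realType} {F : scalars R} {emb : {rmorphism R -> F}}.
Hypothesis vF : valued_scalars emb.
Implicit Types (x y : nat -> F) (A : seqspace F) (T : (nat -> F) -> nat -> F).

Lemma mod0 : modulus (0 : F) = 0.
Proof. by rewrite -(rmorph0 emb) (mod_emb vF) normr0. Qed.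

Lemma mod_sum n x : modulus (\sum_(k < n) x k) <= \sum_(k < n) modulus (x k).
Proof.
elim: n => [|n IH]; first by rewrite !big_ord0 mod0.
by rewrite !big_ord_recr/= (le_trans (modD vF _ _))// lerD2r.
Qed.

Lemma nrm_ell_ge0 (p : \bar R) x : 0 <= nrm (ell p) x.
Proof. by apply: fine_ge0; exact: Lnorm_ge0. Qed.

Lemma ell_sum_le p x n : 0 < p -> ell p%:E x ->
  \sum_(k < n) modulus (x k) `^ p <= nrm (ell p%:E) x `^ p.
Proof.
move=> p0 xp; move: n.
by apply/(ellP (mod_ge0 vF))/(conj xp); rewrite ?nrm_ell_ge0.
Qed.

Lemma ell1P x r : 0 <= r ->
  ell 1%:E x /\ nrm (ell 1%:E) x <= r <-> forall n, \sum_(k < n) modulus (x k) <= r.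
Proof.
move=> r0; rewrite (ellP (mod_ge0 vF)) ?ltr01// powRr1//.
have E n : \sum_(k < n) modulus (x k) `^ 1 = \sum_(k < n) modulus (x k).
  by apply: eq_bigr => k _; rewrite powRr1// (mod_ge0 vF).
by split => h n; have := h n; rewrite E.
Qed.

Lemma ell1_sum_le x n : ell 1%:E x ->
  \sum_(k < n) modulus (x k) <= nrm (ell 1%:E) x.
Proof. by move=> x1; move: n; apply/ell1P/(conj x1); rewrite ?nrm_ell_ge0. Qed.

Lemma ell_oo_le x k : ell +oo%E x -> modulus (x k) <= nrm (ell +oo%E) x.
Proof.
move=> xo; move: k.
by apply/(ell_ooP (mod_ge0 vF))/(conj xo); rewrite ?nrm_ell_ge0.
Qed.

Lemma ell_0 (p : R) : 0 < p -> ell p%:E (0 : nat -> F).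
Proof.
move=> p0; suff [] : ell p%:E (0 : nat -> F) /\ nrm (ell p%:E) (0 : nat -> F) <= 0 by [].
apply/(ellP (mod_ge0 vF)) => // n.
by rewrite big1 ?powR_ge0// => k _; rewrite mod0 powR0 ?gt_eqF.
Qed.

Lemma ell_add (p : R) x y : 0 < p -> ell p%:E x -> ell p%:E y -> ell p%:E (x + y).
Proof.
move=> p0 xp yp; pose m := nrm (ell p%:E) x `^ p + nrm (ell p%:E) y `^ p.
have m0 : 0 <= 2 `^ p * m by rewrite mulr_ge0 ?addr_ge0 ?powR_ge0.
suff [] : ell p%:E (x + y) /\ nrm (ell p%:E) (x + y) <= (2 `^ p * m) `^ p^-1 by [].
apply/(ellP (mod_ge0 vF)); rewrite ?powR_ge0// => n.
rewrite -powRrM mulVf ?gt_eqF// powRr1//.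
apply: (@le_trans _ _ (\sum_(k < n) 2 `^ p * (modulus (x k) `^ p + modulus (y k) `^ p))).
  apply: ler_sum => k _.
  apply: le_trans _ (powRD_le (ltW p0) (mod_ge0 vF _) (mod_ge0 vF _)).
  by apply: powR_le; rewrite ?(mod_ge0 vF) ?(modD vF) ?(ltW p0).
by rewrite -mulr_sumr big_split/= ler_wpM2l ?powR_ge0// lerD ?ell_sum_le.
Qed.

Lemma ell_emb q (g : nat -> R) b : 0 < q -> (forall k, 0 <= g k) ->
  (forall n, \sum_(k < n) g k `^ q <= b) -> ell q%:E (emb \o g).
Proof.
move=> q0 g0 gb; have b0 : 0 <= b by have := gb 0%N; rewrite big_ord0.
suff [] : ell q%:E (emb \o g) /\ nrm (ell q%:E) (emb \o g) <= b `^ q^-1 by [].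
apply/(ellP (mod_ge0 vF)); rewrite ?powR_ge0// => n.
rewrite -powRrM mulVf ?gt_eqF// powRr1//; apply: le_trans (gb n).
by apply: ler_sum => k _; rewrite /= (mod_emb vF) ger0_norm.
Qed.

(** Each modulus is at most [r], the l^1 norm, so its power [q] is at most [r^(q-1)] times
    itself. *)
Lemma ell1_subset q x : 1 <= q -> ell 1%:E x -> ell q%:E x.
Proof.
move=> q1 x1; have q0 : 0 < q by exact: lt_le_trans ltr01 q1.
pose r := nrm (ell 1%:E) x.
suff [] : ell q%:E x /\ nrm (ell q%:E) x <= r by [].
apply/(ellP (mod_ge0 vF)); rewrite ?nrm_ell_ge0// => n.
have xr k : modulus (x k) <= r.
  apply: le_trans (ell1_sum_le k.+1 x1); rewrite big_ord_recr/= lerDr sumr_ge0// => i _.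
  exact: (mod_ge0 vF).
have r0 : 0 <= r by exact: nrm_ell_ge0.
apply: (@le_trans _ _ (\sum_(k < n) modulus (x k) * r `^ (q - 1))).
  apply: ler_sum => k _; rewrite -(mulr_powRB1 (mod_ge0 vF _) q0).
  by rewrite ler_wpM2l ?(mod_ge0 vF)// powR_le ?(mod_ge0 vF) ?subr_ge0.
by rewrite -mulr_suml -(mulr_powRB1 r0 q0) ler_wpM2r ?powR_ge0 ?ell1_sum_le.
Qed.

Lemma couple_sum_ell q x : 1 <= q ->
  couple_sum (ell 1%:E) (ell q%:E) x <-> ell q%:E x.
Proof.
move=> q1; have q0 : 0 < q by exact: lt_le_trans ltr01 q1.
split => [[a0 [a1 [x0 x1 ->]]]|xq]; first by apply: ell_add => //; exact: ell1_subset.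
by exists 0, x; split => //; [exact: ell_0|rewrite add0r].
Qed.

Lemma scale1seq x : 1 \*o x = x.
Proof. by apply/funext => k; rewrite /= mul1r. Qed.

Definition contracts T A := forall x, A x -> A (T x) /\ nrm A (T x) <= nrm A x.

Lemma couple_contractionI A0 A1 T :
  (forall (a : F) x y, T (a \*o x + y) = a \*o T x + T y) ->
  contracts T A0 -> contracts T A1 -> couple_contraction A0 A1 T.
Proof.
move=> linT T0 T1; split => // x [a0 [a1 [Aa0 Aa1 ->]]].
exists (T a0), (T a1); split; [exact: (T0 _ _).1|exact: (T1 _ _).1|].
by rewrite -[a0 in LHS]scale1seq linT scale1seq.
Qed.

(** A zero weight discards a coordinate, so [p] has to be injective only where [w] is nonzero. Such
    maps lead from a sequence to its rearrangement and back. *)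
Definition weighted_reindex (w : nat -> F) (p : nat -> nat) x : nat -> F :=
  fun k => w k * x (p k).

Lemma weighted_reindex_linear w p (a : F) x y :
  weighted_reindex w p (a \*o x + y) =
  a \*o weighted_reindex w p x + weighted_reindex w p y.
Proof. by apply/funext => k; rewrite /weighted_reindex/= /GRing.add/=; ring. Qed.

Section WeightedReindex.
Variables (w : nat -> F) (p : nat -> nat).
Hypothesis w1 : forall k, modulus (w k) <= 1.
Hypothesis p_inj : forall i j, w i != 0 -> w j != 0 -> p i = p j -> i = j.

Let wx x k : modulus (weighted_reindex w p x k) <= modulus (x (p k)).
Proof. by rewrite (modM vF) ler_piMl ?(mod_ge0 vF). Qed.

Lemma weighted_reindex_ell r : 0 < r -> contracts (weighted_reindex w p) (ell r%:E).
Proof.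
move=> r0 x xr; apply/(ellP (mod_ge0 vF)); rewrite ?nrm_ell_ge0// => n.
have inj : {in [pred k | w k != 0] &, injective p} by move=> i j; exact: p_inj.
have [m hm] := @sum_inj_le R (fun k => modulus (x k) `^ r) [pred k | w k != 0] p n
  (fun k => powR_ge0 _ _) inj.
apply: le_trans (ell_sum_le m r0 xr); apply: le_trans hm.
rewrite [leRHS]big_mkcond; apply: ler_sum => k _ /=; case: ifPn => [_|].
  by apply: powR_le; rewrite ?(mod_ge0 vF) ?(ltW r0).
by rewrite negbK /weighted_reindex => /eqP ->; rewrite mul0r mod0 powR0 ?gt_eqF.
Qed.

Lemma weighted_reindex_ell_oo : contracts (weighted_reindex w p) (ell +oo%E).
Proof.
move=> x xo; apply/(ell_ooP (mod_ge0 vF)); rewrite ?nrm_ell_ge0// => k.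
exact: le_trans (wx x k) (ell_oo_le _ xo).
Qed.

(** The case [+oo] serves the interpolation hypothesis on [E], the finite case the comparison of
    K-functionals. *)
Lemma weighted_reindex_contraction (r : \bar R) : r = +oo%E \/ (exists2 s, 0 < s & r = s%:E) ->
  couple_contraction (ell 1%:E) (ell r) (weighted_reindex w p).
Proof.
move=> hr; apply: couple_contractionI.
- exact: weighted_reindex_linear.
- exact: weighted_reindex_ell.
- by case: hr => [->|[s s0 ->]]; [exact: weighted_reindex_ell_oo|exact: weighted_reindex_ell].
Qed.

End WeightedReindex.

(** Rows are finite, so the operator acts on every sequence without a question of convergence. *)
Definition triangular (M : nat -> nat -> R) x : nat -> F :=
  fun i => \sum_(j < i.+1) emb (M i j) * x j.

(** Column sums control the l^1 norm after exchanging summations, and row sums control the l^oo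
    norm. *)
Lemma triangular_contraction (M : nat -> nat -> R) :
  (forall i j, 0 <= M i j) -> (forall i, \sum_(j < i.+1) M i j <= 1) ->
  (forall i j, (i < j)%N -> M i j = 0) -> (forall n j, \sum_(i < n) M i j <= 1) ->
  couple_contraction (ell 1%:E) (ell +oo%E) (triangular M).
Proof.
move=> M0 row upper col.
have modT x i : modulus (triangular M x i) <= \sum_(j < i.+1) M i j * modulus (x j).
  apply: le_trans (mod_sum i.+1 (fun j => emb (M i j) * x j)) _.
  by apply: ler_sum => j _; rewrite (modM vF) (mod_emb vF) ger0_norm.
apply: couple_contractionI.
- move=> a x y; apply/funext => i; rewrite /triangular /GRing.add/= mulr_sumr -big_split/=.
  by apply: eq_bigr => j _; ring.
- move=> x x1; apply/ell1P; rewrite ?nrm_ell_ge0// => n.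
  apply: le_trans (ell1_sum_le n x1).
  apply: (@le_trans _ _ (\sum_(i < n) \sum_(j < n) M i j * modulus (x j))).
    apply: ler_sum => i _; apply: le_trans (modT x i) _.
    rewrite -!(big_mkord xpredT (fun j => M i j * modulus (x j))).
    rewrite [leRHS](big_cat_nat (leq0n i.+1) (ltn_ord i))/= lerDl.
    by rewrite sumr_ge0// => j _; rewrite mulr_ge0 ?(mod_ge0 vF).
  rewrite exchange_big/=; apply: ler_sum => j _.
  by rewrite -mulr_suml ler_piMl ?(mod_ge0 vF) ?col.
- move=> x xo; apply/(ell_ooP (mod_ge0 vF)); rewrite ?nrm_ell_ge0// => i.
  apply: le_trans (modT x i) _.
  apply: (@le_trans _ _ (\sum_(j < i.+1) M i j * nrm (ell +oo%E) x)).
    by apply: ler_sum => j _; rewrite ler_wpM2l ?ell_oo_le.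
  by rewrite -mulr_suml ler_piMl ?nrm_ell_ge0 ?row.
Qed.

Definition reindexes x y := exists w p,
  [/\ forall k, modulus (w k) <= 1,
      forall i j, w i != 0 -> w j != 0 -> p i = p j -> i = j
    & weighted_reindex w p x = y].

Lemma mod_div_le (a b : F) : modulus a <= modulus b -> modulus (a / b) <= 1.
Proof.
move=> ab; have [->|b0] := eqVneq b 0; first by rewrite invr0 mulr0 mod0 ler01.
have mb : 0 < modulus b.
  rewrite lt_neqAle (mod_ge0 vF) andbT eq_sym.
  by apply: contra b0 => /eqP/(mod_eq0 vF) ->.
by rewrite -(ler_pM2r mb) -(modM vF) divfK// mul1r.
Qed.

Lemma mod_divK (a b : F) : modulus a <= modulus b -> a / b * b = a.
Proof.
have [->|b0 _] := eqVneq b 0; last by rewrite divfK.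
rewrite mod0 mulr0 => a0; apply/esym/(mod_eq0 vF)/eqP.
by rewrite eq_le a0 (mod_ge0 vF).
Qed.

(** [f] lists the moduli along a decreasing enumeration, and the weights toward [f] remove the
    phases. Back from a majorant [z], the weights are [x k] divided by the matching term of [z];
    this lets a bound on a majorant reach [x] itself. *)
Lemma nonincreasing_rearrangement q x : 0 < q -> ell q%:E x ->
  exists f : nat -> R,
  [/\ forall k, 0 <= f k, forall k, f k.+1 <= f k,
      exists b, forall n, \sum_(k < n) f k `^ q <= b,
      reindexes x (emb \o f)
    & forall z : nat -> R, (forall k, f k <= z k) -> reindexes (emb \o z) x].
Proof.
move=> q0 xq.
have h0 k : 0 <= modulus (x k) `^ q by exact: powR_ge0.
have hb n := ell_sum_le n q0 xq.
have [sigma [sigma_inj sigma_ni sigma_supp]] := decreasing_enumeration h0 hb.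
exists (fun n => modulus (x (sigma n))); split.
- by move=> k; exact: (mod_ge0 vF).
- move=> k; rewrite leNgt; apply/negP => lt.
  have := sigma_ni k; rewrite leNgt => /negP; apply.
  by apply: gt0_ltr_powR; rewrite ?nnegrE ?(mod_ge0 vF).
- exists (nrm (ell q%:E) x `^ q) => n.
  have [m hm] := @sum_inj_le R (fun k => modulus (x k) `^ q) xpredT
    sigma n h0 (in2W sigma_inj).
  exact: le_trans hm (hb m).
- exists (fun n => emb (modulus (x (sigma n))) / x (sigma n)), sigma.
  have modE n : modulus (emb (modulus (x (sigma n)))) = modulus (x (sigma n)).
    by rewrite (mod_emb vF) ger0_norm ?(mod_ge0 vF).
  split=> [n|i j _ _ /sigma_inj//|]; first by rewrite mod_div_le ?modE.
  by apply/funext => n; rewrite /weighted_reindex /= mod_divK ?modE.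
- move=> z fz.
  (* [p] inverts [sigma] on the support of [x]; elsewhere its value is arbitrary and the weight is
     0. *)
  have /choice[p pE] : forall k, exists n, x k != 0 -> sigma n = k.
    move=> k; have [xk|xk] := eqVneq (x k) 0; first by exists 0%N.
    have [|n <-] := sigma_supp k; last by exists n.
    by apply: contra xk => /eqP/powR_eq0_eq0/(mod_eq0 vF) ->.
  have xz k : modulus (x k) <= modulus (emb (z (p k))).
    have [->|xk] := eqVneq (x k) 0; first by rewrite mod0 (mod_ge0 vF).
    rewrite (mod_emb vF) -{1}(pE _ xk); apply: le_trans (fz _) _; exact: ler_norm.
  exists (fun k => x k / emb (z (p k))), p; split=> [k|i j|].
  + exact: mod_div_le.
  + rewrite !mulf_eq0 !negb_or => /andP[xi _] /andP[xj _] pij.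
    by rewrite -(pE i xi) pij pE.
  + by apply/funext => k; rewrite /weighted_reindex /= mod_divK.
Qed.

(** * The K-functional of the couple (l^1, l^q) *)

Section Kfunctional.
Variable q : R.
Hypothesis q1 : 1 < q.

Let K t x := Kfun (ell 1%:E) (ell q%:E) t x.
Let q0 : 0 < q. Proof. exact: lt_trans ltr01 q1. Qed.

Lemma Kfun_le t x0 x1 : 0 < t -> ell 1%:E x0 -> ell q%:E x1 ->
  K t (x0 + x1) <= nrm (ell 1%:E) x0 + t * nrm (ell q%:E) x1.
Proof.
move=> t0 e0 e1; apply: ge_inf; last by exists x0, x1.
exists 0 => r [y0 [y1 [_ _ _ ->]]].
by rewrite addr_ge0 ?mulr_ge0 ?nrm_ell_ge0// ltW.
Qed.

Lemma le_Kfun t x m : ell q%:E x ->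
  (forall x0 x1, ell 1%:E x0 -> ell q%:E x1 -> x = x0 + x1 ->
    m <= nrm (ell 1%:E) x0 + t * nrm (ell q%:E) x1) ->
  m <= K t x.
Proof.
move=> xq hm; apply: lb_le_inf; last by move=> r [x0 [x1 [? ? ? ->]]]; exact: hm.
(* The decomposition [0 + x] shows that the infimum is over a nonempty set. *)
exists (nrm (ell 1%:E) (0 : nat -> F) + t * nrm (ell q%:E) x), 0, x.
by split => //; [exact: ell_0|rewrite add0r].
Qed.

(** The image of a decomposition of [x] decomposes [T x] at no greater cost. *)
Lemma Kfun_contraction T t x : couple_contraction (ell 1%:E) (ell q%:E) T ->
  0 < t -> ell q%:E x -> K t (T x) <= K t x.
Proof.
move=> [_ linT T0 T1] t0 xq; apply: le_Kfun => // x0 x1 e0 e1 ->.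
rewrite -{1}[x0]scale1seq linT; last 2 first.
- by apply/(couple_sum_ell _ (ltW q1)); exact/ell1_subset/e0/ltW.
- by apply/(couple_sum_ell _ (ltW q1)).
rewrite scale1seq.
have [? ?] := T0 _ e0; have [? ?] := T1 _ e1.
apply: le_trans (Kfun_le t0 _ _) _ => //.
by rewrite lerD// ler_wpM2l// ltW.
Qed.


(** Tests the infimum on the cut of [f] at [N]: the first [N] terms in l^1, the rest in l^q. *)
Lemma Kfun_upper (f : nat -> R) (N : nat) (b : R) (t := N%:R `^ (1 - q^-1)) :
  (forall k, 0 <= f k) ->
  (forall n, \sum_(k < n) f k `^ q <= b) -> (0 < N)%N ->
  K t (emb \o f) <= \sum_(k < N) f k + t * tail (fun k => f k `^ q) N `^ q^-1.
Proof.
move=> f0 fb N0.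
pose x0 : nat -> F := fun k => if (k < N)%N then emb (f k) else 0.
pose x1 : nat -> F := fun k => if (k < N)%N then 0 else emb (f k).
have -> : emb \o f = x0 + x1.
  by apply/funext => k; rewrite /x0 /x1 /GRing.add/=; case: ifP => _; rewrite ?addr0 ?add0r.
have modf k : modulus (emb (f k)) = f k by rewrite (mod_emb vF) ger0_norm.
have t0 : 0 < t by rewrite powR_gt0 ?ltr0n.
have W0 : 0 <= tail (fun k => f k `^ q) N by exact: tail_ge0 fb.
have [e0 n0] : ell 1%:E x0 /\ nrm (ell 1%:E) x0 <= \sum_(k < N) f k.
  apply/ell1P => [|n]; first exact: sumr_ge0.
  apply: (@le_trans _ _ (\sum_(k < maxn n N) modulus (x0 k))).
    rewrite -!(big_mkord xpredT (fun k => modulus (x0 k))).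
    rewrite [leRHS](big_cat_nat (leq0n n) (leq_maxl _ _))/= lerDl sumr_ge0// => k _.
    exact: (mod_ge0 vF).
  rewrite -(big_mkord xpredT (fun k => modulus (x0 k))).
  rewrite (big_cat_nat (leq0n N) (leq_maxr _ _))/= [X in _ + X]big1_seq ?addr0; last first.
    by move=> k; rewrite mem_index_iota => /= /andP[Nk _]; rewrite /x0 ltnNge Nk mod0.
  rewrite big_mkord; apply: ler_sum => k _; by rewrite /x0 ltn_ord modf.
have [e1 n1] : ell q%:E x1 /\ nrm (ell q%:E) x1 <= tail (fun k => f k `^ q) N `^ q^-1.
  apply/(ellP (mod_ge0 vF)) => //; first exact: powR_ge0.
  move=> n; rewrite -powRrM mulVf ?gt_eqF// powRr1//.
  apply: le_trans (le_tail fb (leq_maxr n N)).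
  apply: (@le_trans _ _ (\sum_(k < maxn n N) modulus (x1 k) `^ q)).
    rewrite -!(big_mkord xpredT (fun k => modulus (x1 k) `^ q)).
    rewrite [leRHS](big_cat_nat (leq0n n) (leq_maxl _ _))/= lerDl sumr_ge0// => k _.
    exact: powR_ge0.
  rewrite -(big_mkord xpredT (fun k => modulus (x1 k) `^ q)).
  rewrite (big_cat_nat (leq0n N) (leq_maxr _ _))/= [X in X + _]big1_seq ?add0r; last first.
    by move=> k; rewrite mem_index_iota /x1 => /= ->; rewrite mod0 powR0 ?gt_eqF.
  apply: ler_sum_nat => k /andP[Nk _]; by rewrite /x1 ltnNge Nk /= modf.
by apply: le_trans (Kfun_le t0 e0 e1) _; rewrite lerD// ler_wpM2l// ltW.
Qed.

(** Applies the two decomposition estimates to the moduli of an arbitrary decomposition, then takes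
    the infimum. *)
Lemma Kfun_lower (g : nat -> R) (N : nat) (b : R) (t := N%:R `^ (1 - q^-1)) :
  (forall k, 0 <= g k) -> (forall k, g k.+1 <= g k) ->
  (forall n, \sum_(k < n) g k `^ q <= b) -> (0 < N)%N ->
  \sum_(k < N) g k <= 4 * K t (emb \o g) /\
  t * tail (fun k => g k `^ q) N `^ q^-1 <= 4 * K t (emb \o g).
Proof.
move=> g0 gni gb N0.
have modg k : modulus (emb (g k)) = g k by rewrite (mod_emb vF) ger0_norm.
have t0 : 0 < t by rewrite powR_gt0 ?ltr0n.
have gq : ell q%:E (emb \o g) by exact: (ell_emb q0 g0 gb).
have dec x0 x1 : emb \o g = x0 + x1 -> forall k, g k <= modulus (x0 k) + modulus (x1 k).
  by move=> e k; rewrite -modg -[emb (g k)]/((emb \o g) k) e; exact: (modD vF).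
rewrite -![_ <= 4 * _]ler_pdivrMl//; split; apply: le_Kfun => // x0 x1 e0 e1 e.
  rewrite ler_pdivrMl//.
  exact: (decomposition_head_le q1 N0 (fun k => mod_ge0 vF (x1 k)) (dec _ _ e)
    (nrm_ell_ge0 _ x0) (nrm_ell_ge0 _ x1) (fun n => ell1_sum_le n e0)
    (fun n => ell_sum_le n q0 e1)).
rewrite ler_pdivrMl//.
set m := nrm _ x0 + _.
have m0 : 0 <= m by rewrite addr_ge0 ?mulr_ge0 ?nrm_ell_ge0// ltW.
suff : tail (fun k => g k `^ q) N <= (4 * m / t) `^ q.
  move=> /(@powR_le _ q^-1 _ _ _ _); rewrite -powRrM divff ?gt_eqF// powRr1.
    rewrite ler_pdivlMr// mulrC; apply; first by rewrite invr_ge0 ltW.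
    exact: tail_ge0 gb.
  by rewrite divr_ge0 ?mulr_ge0// ltW.
apply: tail_le => [k|M NM]; first exact: powR_ge0.
have : t * (\sum_(N <= k < M) g k `^ q) `^ q^-1 <= 4 * m.
  exact: (decomposition_tail_le q1 N0 g0 gni (fun k => mod_ge0 vF (x0 k))
    (fun k => mod_ge0 vF (x1 k)) (dec _ _ e)
    (nrm_ell_ge0 _ x0) (nrm_ell_ge0 _ x1) (fun n => ell1_sum_le n e0)
    (fun n => ell_sum_le n q0 e1) NM).
rewrite mulrC -ler_pdivlMr// => /(@powR_le _ q _ _ (ltW q0) (powR_ge0 _ _)).
by rewrite -powRrM mulVf ?gt_eqF// powRr1// sumr_ge0// => k _; exact: powR_ge0.
Qed.

End Kfunctional.
End Contractions.

(** * The main theorem *)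

(* Raising the first term of [g] makes the totals equal; since the tails of [g]
   are dominated by those of [u], the partial sums then dominate. *)
Lemma raise_first_term (R : realType) (q bu bg : R) (u g : nat -> R) :
  0 < q -> (forall k, 0 <= g k) -> (forall k, g k.+1 <= g k) ->
  (forall n, \sum_(k < n) u k `^ q <= bu) ->
  (forall n, \sum_(k < n) g k `^ q <= bg) ->
  (forall N, tail (fun k => g k `^ q) N <= tail (fun k => u k `^ q) N) ->
  exists v : nat -> R,
  [/\ forall k, v k.+1 <= v k, forall k, g k <= v k,
      forall N : nat, \sum_(k < N) u k `^ q <= \sum_(k < N) v k `^ q,
      forall N : nat, \sum_(k < N) v k `^ q <= nnsum (fun k => u k `^ q)
    & nnsum (fun k => v k `^ q) = nnsum (fun k => u k `^ q)].
Proof.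
move=> q0 g0 gni ub gb gu.
set U := nnsum (fun k => u k `^ q); set G := nnsum (fun k => g k `^ q).
have GU : G <= U by rewrite -[G]tail0 -[U]tail0.
(* The power [q] of the raised first term: it adds exactly the missing total [U - G]. *)
pose d := U - G + g 0%N `^ q.
have gd : g 0%N `^ q <= d by rewrite lerDr subr_ge0.
have d0 : 0 <= d by apply: le_trans gd; exact: powR_ge0.
pose v k := if k is 0%N then d `^ q^-1 else g k.
have g0v : g 0%N <= v 0%N.
  have -> : g 0%N = (g 0%N `^ q) `^ q^-1 by rewrite -powRrM divff ?gt_eqF// powRr1.
  by apply: powR_le; rewrite ?powR_ge0// invr_ge0 ltW.
have sumv N : \sum_(k < N.+1) v k `^ q = U - G + \sum_(k < N.+1) g k `^ q.
  rewrite !big_ord_recl/= -powRrM mulVf ?gt_eqF// powRr1//.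
  by rewrite /d addrA.
have sumv_le N : \sum_(k < N) v k `^ q <= U.
  case: N => [|N].
    by rewrite big_ord0 -[U]tail0; exact: tail_ge0 ub.
  by rewrite sumv -lerBrDl subKr; exact: le_nnsum gb.
exists v; split=> //.
- by case=> [|k] /=; [exact: le_trans g0v|].
- by case.
- case=> [|N]; first by rewrite !big_ord0.
  rewrite sumv; have := gu N.+1; rewrite /tail -/U -/G; lra.
- apply/eqP; rewrite eq_le nnsum_le//=.
  have sumvV N : \sum_(k < N) v k `^ q <= nnsum (fun k => v k `^ q).
    exact: (@le_nnsum _ (fun k => v k `^ q) U).
  have : G <= nnsum (fun k => v k `^ q) - U + G.
    apply: nnsum_le => -[|n].
      rewrite big_ord0; have := sumvV 1%N; rewrite sumv big_ord_recl big_ord0/=.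
      have := powR_ge0 (g 0%N) q; lra.
    by have := sumvV n.+1; rewrite sumv; lra.
  lra.
Qed.

Section Interpolation.
Context {R : realType} {F : scalars R} {emb : {rmorphism R -> F}}.
Hypothesis vF : valued_scalars emb.
Variables (q C1 C2 : R) (E : seqspace F).
Hypotheses (q1 : 1 < q) (C10 : 0 < C1) (C20 : 0 < C2).
Hypothesis normedE : normed_seqspace E.
Hypothesis Eq : carrier E `<=` carrier (ell q%:E).
Hypothesis SE : property_S q C1 E.
Hypothesis interE : interpolation_space C2 (ell 1%:E) (ell +oo%E) E.
Implicit Types (x y : nat -> F) (f g z : nat -> R).

Let q0 : 0 < q. Proof. exact: lt_trans ltr01 q1. Qed.

Lemma emb_scale c f : emb \o (fun k => c * f k) = emb c \*o (emb \o f).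
Proof. by apply/funext => k /=; rewrite rmorphM. Qed.

Lemma nrm_emb_scale c f : 0 <= c -> E (emb \o f) ->
  E (emb \o (fun k => c * f k)) /\
  nrm E (emb \o (fun k => c * f k)) = c * nrm E (emb \o f).
Proof.
move=> c0 Ef; rewrite emb_scale.
have [[_ _ scaleE] [_ _ nrmZ _] _] := normedE.
by split; [exact: scaleE|rewrite nrmZ// (mod_emb vF) ger0_norm].
Qed.

Lemma reindexes_interpolation x y : reindexes x y -> E x ->
  E y /\ nrm E y <= C2 * nrm E x.
Proof.
move=> [w [p [w1 pinj <-]]] Ex; have [_ _ interp] := interE; apply: interp => //.
by apply: (weighted_reindex_contraction vF w1 pinj); left.
Qed.

Lemma reindexes_Kfun t x y : reindexes x y -> 0 < t -> ell q%:E x ->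
  Kfun (ell 1%:E) (ell q%:E) t y <= Kfun (ell 1%:E) (ell q%:E) t x.
Proof.
move=> [w [p [w1 pinj <-]]] t0 xq; apply: (Kfun_contraction vF q1) => //.
by apply: (weighted_reindex_contraction vF w1 pinj); right; exists q.
Qed.

(** Half of the transport matrix is a contraction of both spaces and maps [2 * f] to [g], hence the
    factor 2. *)
Lemma majorized_interpolation f g :
  (forall k, 0 <= f k) -> (forall k, 0 <= g k) -> (forall k, g k.+1 <= g k) ->
  (forall N : nat, \sum_(k < N) g k <= \sum_(k < N) f k) ->
  E (emb \o f) ->
  E (emb \o g) /\ nrm E (emb \o g) <= C2 * (2 * nrm E (emb \o f)).
Proof.
move=> f0 g0 gni gf Ef.
have [M [M0 row upper col Mf]] := triangular_transport f0 g0 gni gf.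
have [Ef2 <-] := nrm_emb_scale (ler0n R 2) Ef.
have <- : triangular (emb := emb) (fun i j => M i j / 2)
    (emb \o (fun k => 2 * f k)) = emb \o g.
  apply/funext => i; rewrite /triangular /= -Mf rmorph_sum/=.
  by apply: eq_bigr => j _; rewrite -rmorphM mulrA divfK.
have [_ _ interp] := interE; apply: interp => //.
apply: (triangular_contraction vF).
- by move=> i j; rewrite divr_ge0.
- by move=> i; rewrite -mulr_suml ler_pdivrMr// mul1r.
- by move=> i j ij; rewrite upper// mul0r.
- move=> n j; rewrite -mulr_suml ler_pdivrMr// mul1r (le_trans (col n j))//.
  by rewrite ler1n.
Qed.

(** [property_S] is applied to [u] and to [g] with its first term raised; both are their own
    rearrangements. A majorant of [g] in [E] is enough for the final reindexing. *)
Lemma tail_dominated_S u g bu bg :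
  (forall k, 0 <= u k) -> (forall k, u k.+1 <= u k) ->
  (forall k, 0 <= g k) -> (forall k, g k.+1 <= g k) ->
  (forall n, \sum_(k < n) u k `^ q <= bu) ->
  (forall n, \sum_(k < n) g k `^ q <= bg) ->
  (forall N, tail (fun k => g k `^ q) N <= tail (fun k => u k `^ q) N) ->
  E (emb \o u) ->
  exists v, [/\ forall k, g k <= v k, E (emb \o v)
    & nrm E (emb \o v) <= C1 * nrm E (emb \o u)].
Proof.
move=> u0 uni g0 gni ub gb gu Eu.
have [v [vni gv uv vb vu]] := raise_first_term q0 g0 gni ub gb gu.
exists v; have v0 k : 0 <= v k by exact: le_trans (gv k).
have modE h k : (forall k, 0 <= h k) -> modulus ((emb \o h) k) = h k.
  by move=> h0; rewrite /= (mod_emb vF) ger0_norm.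
have rearrE h : (forall k, 0 <= h k) -> (forall k, h k.+1 <= h k) ->
    rearr (emb \o h) = h.
  move=> h0 hni; apply/funext => n.
  by rewrite rearr_nincr ?modE// => k; rewrite !modE.
suff [] : E (emb \o v) /\ nrm E (emb \o v) <= C1 * nrm E (emb \o u) by split.
apply: SE Eu.
- exact: (ell_emb vF q0 u0 ub).
- exact: (ell_emb vF q0 v0 vb).
- by move=> N; rewrite !rearrE.
- rewrite !rearrE// (nneseries_nnsum _ ub) ?(nneseries_nnsum _ vb) ?vu// => k;
  exact: powR_ge0.
Qed.

(** The outer factors [C2] pay for passing from [x] to [f] and from the majorant of [g] to [y];
    [32 * C2] comes from [G0] and [16 * C1] from the majorant of [G1]. *)
Lemma Kfun_dominated x y : ell q%:E y ->
  (forall t, 0 < t ->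
     Kfun (ell 1%:E) (ell q%:E) t y <= Kfun (ell 1%:E) (ell q%:E) t x) ->
  E x -> E y /\ nrm E y <= C2 * (32 * C2 + 16 * C1) * C2 * nrm E x.
Proof.
move=> yq Kyx Ex; have xq := Eq Ex.
have [f [f0 fni [bf fb] xf fx]] := nonincreasing_rearrangement vF q0 xq.
have [g [g0 gni [bg gb] yg gy]] := nonincreasing_rearrangement vF q0 yq.
have [Ef nf] := reindexes_interpolation xf Ex.
have fq := ell_emb vF q0 f0 fb.
pose Wf := tail (fun k => f k `^ q); pose Wg := tail (fun k => g k `^ q).
have Wf0 N : 0 <= Wf N by exact: tail_ge0 fb.
have Wg0 N : 0 <= Wg N by exact: tail_ge0 gb.
(* The index [N] counts from 0, so its head consists of [N.+1] terms. *)
pose H N := \sum_(k < N.+1) g k <= 8 * \sum_(k < N.+1) f k.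
have dich N : ~~ H N -> Wg N.+1 <= 8 `^ q * Wf N.+1
     /\ N.+1%:R * g N `^ q <= 8 `^ q * Wf N.+1.
  rewrite -ltNge => fgN; pose t : R := N.+1%:R `^ (1 - q^-1).
  have t0 : 0 < t by exact: powR_gt0.
  have [Ag Bg] := Kfun_lower vF q1 g0 gni gb (ltn0Sn N).
  have Kf := Kfun_upper vF q1 f0 fb (ltn0Sn N).
  (* Passes from [g] to [y], then to [x] by hypothesis, then to [f]. *)
  have Kgf : Kfun (ell 1%:E) (ell q%:E) t (emb \o g) <=
             Kfun (ell 1%:E) (ell q%:E) t (emb \o f).
    apply: le_trans (reindexes_Kfun yg t0 yq) _; apply: le_trans (Kyx _ t0) _.
    exact: reindexes_Kfun (fx f (fun=> lexx _)) t0 fq.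
  have K4 : 4 * Kfun (ell 1%:E) (ell q%:E) t (emb \o g) <=
      4 * (\sum_(k < N.+1) f k + t * Wf N.+1 `^ q^-1).
    by rewrite ler_pM2l//; exact: le_trans Kgf Kf.
  apply: (head_tail_dichotomy q1 (ltn0Sn N) (Wf0 _) (Wg0 _) (g0 N) _
    (le_trans Ag K4) (le_trans Bg K4) fgN).
  rewrite mulr_natl -[X in _ *+ X]subn0 -sumr_const_nat -(big_mkord xpredT g).
  by apply: ler_sum_nat => k /andP[_ kN]; exact: nonincr_le.
pose G0 := envelope H g; pose G1 := envelope (predC H) g.
have G00 k : 0 <= G0 k by exact: envelope_ge0.
have G10 k : 0 <= G1 k by exact: envelope_ge0.
have c8 : 0 <= 8 :> R by [].
have [Ef16 n16] := nrm_emb_scale (ler0n R 16) Ef.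
have f160 k : 0 <= 16 * f k by rewrite mulr_ge0.
have [EG0 nG0] : E (emb \o G0) /\ nrm E (emb \o G0) <= C2 * (2 * (16 * nrm E (emb \o f))).
  rewrite -n16; apply: majorized_interpolation => // [k|N].
    exact: envelope_nincr.
  rewrite -mulr_sumr; have := head_envelope_le f0 fni g0 gni c8 (fun N => id) N.
  by rewrite -natrM.
have powE k : (16 * f k) `^ q = 16 `^ q * f k `^ q by rewrite powRM.
have c16 : 0 < 16 `^ q :> R by exact: powR_gt0.
have [v [G1v Ev nv]] : exists v, [/\ forall k, G1 k <= v k, E (emb \o v)
    & nrm E (emb \o v) <= C1 * nrm E (emb \o (fun k => 16 * f k))].
  apply: (@tail_dominated_S _ _ (16 `^ q * bf) bg) => //.
  - by move=> k; rewrite ler_pM2l.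
  - by move=> k; exact: envelope_nincr.
  - move=> n; under eq_bigr do rewrite powE; by rewrite -mulr_sumr ler_pM2l.
  - move=> n; apply: le_trans (gb n); apply: ler_sum => k _.
    by apply: powR_le; [exact: ltW|exact: envelope_ge0|exact: envelope_le_seq].
  - move=> N.
    have -> : tail (fun k => (16 * f k) `^ q) N = 16 `^ q * Wf N.
      rewrite /Wf /tail mulrBr mulr_sumr -(nnsumZ c16 fb); congr (nnsum _ - _).
        by apply/funext => k; exact: powE.
      by apply: eq_bigr => k _; exact: powE.
    have b0 : 0 <= 8 `^ q :> R by exact: powR_ge0.
    apply: le_trans (tail_envelope_le g0 gni q0 b0 fb gb dich N) _.
    rewrite ler_wpM2r//.
    (* [2 * 8^q <= 16^q] because [q >= 1]. *)
    have -> : 16 = 2 * 8 :> R by rewrite -natrM.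
    by rewrite powRM// ler_wpM2r ?powR_ge0// le1r_powR ?ler1n// ltW.
have [[_ addE _] [_ _ _ nrmD] _] := normedE.
have embD : emb \o (fun k => G0 k + v k) = (emb \o G0) + (emb \o v).
  by apply/funext => k; rewrite /GRing.add /= rmorphD.
have [||Ey ny] := @reindexes_interpolation (emb \o (fun k => G0 k + v k)) y.
(* At each index [g] is below [G0] or below [G1 <= v], according to [H], so [G0 + v] is a majorant
   from which [y] is recovered. *)
- apply: gy => k; have [Hk|Hk] := boolP (H k).
    rewrite -[leLHS]addr0 lerD ?(le_trans (G10 k))//; exact: le_envelope.
  rewrite -[leLHS]add0r lerD// (le_trans _ (G1v k))//; exact: le_envelope.
- by rewrite embD; exact: addE.
split => //; apply: le_trans ny _; rewrite embD -!mulrA ler_pM2l//.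
apply: le_trans (nrmD _ _ EG0 Ev) _.
rewrite n16 in nv.
apply: (@le_trans _ _ ((32 * C2 + 16 * C1) * nrm E (emb \o f))); first lra.
by rewrite ler_wpM2l// addr_ge0 ?mulr_ge0 ?ltW.
Qed.

End Interpolation.

Theorem theorem5p3 (R : realType) (q C1 C2 : R)
    (hq : 1 < q) (hC1 : 0 < C1) (hC2 : 0 < C2) :
  exists2 C3 : R, 0 < C3 &
    forall (F : scalars R), F = real_scalars R \/ F = complex_scalars R ->
    forall E : seqspace F,
      normed_seqspace E ->
      carrier E `<=` carrier (ell q%:E) ->
      property_S q C1 E ->
      interpolation_space C2 (ell 1%:E) (ell +oo%E) E ->
      K_space C3 (ell 1%:E) (ell q%:E) E /\
      interpolation_space C3 (ell 1%:E) (ell q%:E) E.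
Proof.
exists (C2 * (32 * C2 + 16 * C1) * C2).
  by rewrite !mulr_gt0// addr_gt0// mulr_gt0.
move=> F /scalars_valued[emb vF] E normedE Eq SE interE.
have sumE x : E x -> couple_sum (ell 1%:E) (ell q%:E) x.
  by move=> /Eq xq; apply/(couple_sum_ell vF _ (ltW hq)).
have KE x y : couple_sum (ell 1%:E) (ell q%:E) y ->
    (forall t, 0 < t ->
       Kfun (ell 1%:E) (ell q%:E) t y <= Kfun (ell 1%:E) (ell q%:E) t x) ->
    E x -> E y /\ nrm E y <= C2 * (32 * C2 + 16 * C1) * C2 * nrm E x.
  by move=> /(couple_sum_ell vF _ (ltW hq)) yq; exact: (Kfun_dominated vF).
split; split=> //; first by move=> x y _; exact: KE.
(* A contraction of the couple does not increase the K-functional, so the interpolation property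
   follows from the K property with the same constant. *)
move=> T Tcontr x Ex; apply: KE => //.
- by case: Tcontr => + _ _ _; apply; exact: sumE.
- by move=> t t0; apply: (Kfun_contraction vF hq) => //; exact: Eq.
Qed.
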